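(* Let $\varphi\in\Phi$ and let $f\in L^{\psi^+}(\Omega)$, where $\psi^+$ is the right derivative of $\varphi$. If $\psi^+$ is a strictly increasing function, then there exists a unique extended best polynomial approximation for each $f\in L^{\psi^+}(\Omega)$, i.e. the set $\mu_{\psi^+}(f)$ has exactly one element.
   Context: $\Omega$ is a bounded Lebesgue measurable subset of $\mathbb{R}^n$ of positive measure; $\int_A f$ means $\int_{\Omega\cap A}f\,dx$ with Lebesgue measure. $\mathcal S$ is the set of non-decreasing functions $\psi:[0,\infty)\to[0,\infty)$ with $\psi(0)=0$, $\psi(s)>0$ for $s>0$, $\psi(s)\to0$ as $s\to0^+$ and $\psi(s)\to\infty$ as $s\to\infty$. A function $\psi$ satisfies the $\Delta_2$ condition if there is a constant $\Lambda_\psi>0$ with $\psi(2s)\leqslant\Lambda_\psi\psi(s)$ for all $s\ge0$. $\Phi$ is the class of functions $\varphi(s)=\int_0^s\psi(r)\,dr$ on $[0,\infty)$, with $\psi\in\mathcal S$, that satisfy the $\Delta_2$ condition. $\psi^-,\psi^+$ denote the left and right derivatives of $\varphi$, with $\psi^-(0)=\psi^+(0)=0$. $L^{\psi^+}(\Omega)$ is the class of real-valued Lebesgue measurable $f$ on $\Omega$ with $\int_\Omega\psi^+(|f|)\,dx<\infty$. $\Pi^m$ is the space of real algebraic polynomials on $\mathbb{R}^n$ of degree at most $m$. For $f\in L^{\psi^+}(\Omega)$, $\mu_{\psi^+}(f)$ is the set of extended best polynomial approximations of $f$: all $P\in\Pi^m$ such that for all $Q\in\Pi^m$ $$\int_{\{f>P\}\cap\{Q>0\}}\psi^-(|f-P|)|Q|\,dx+\int_{\{f<P\}\cap\{Q<0\}}\psi^-(|f-P|)|Q|\,dx\leqslant\int_{\{f<P\}\cap\{Q>0\}}\psi^+(|f-P|)|Q|\,dx+\int_{\{f>P\}\cap\{Q<0\}}\psi^+(|f-P|)|Q|\,dx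 .$$ *)

(* Defs.v *)
From HB Require Import structures.
From mathcomp Require Import all_boot all_order all_algebra.
From mathcomp Require Import all_classical all_reals all_analysis.
From mathcomp Require Import(canonicals,coercions) mpoly.

Set Implicit Arguments.
Unset Strict Implicit.
Unset Printing Implicit Defensive.

Import Order.TTheory GRing.Theory Num.Theory.
Import numFieldNormedType.Exports.

Local Open Scope classical_set_scope.
Local Open Scope ring_scope.

(* The ambient space R^d, d >= 1, is ['rV[R]_n.+1] with d = n.+1. *)
Section lebesgue_outer_measure.
Context {R : realType} {n : nat}.
Local Notation E := 'rV[R]_n.+1.
Implicit Types (p : E * E) (A : set E) (F : nat -> E * E).

(* A box is encoded by its pair of corners; it is empty as soon as one of its
   sides is, in which case its volume is 0. *)
Definition box p : set E :=
  [set x | forall i, p.1 ord0 i <= x ord0 i < p.2 ord0 i].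

Definition box_volume p : R :=
  \prod_(i < n.+1) Num.max 0 (p.2 ord0 i - p.1 ord0 i).

Definition lebesgue_outer A : \bar R :=
  ereal_inf [set (\sum_(k <oo) (box_volume (F k))%:E)%E
            | F in [set F | A `<=` \bigcup_k box (F k)]].

Local Open Scope ereal_scope.

Let vol_ge0 p : 0 <= (box_volume p)%:E.
Proof. by rewrite lee_fin prodr_ge0// => i _; rewrite le_max lexx. Qed.

Let lebesgue_outer_ge0 A : 0 <= lebesgue_outer A.
Proof. by apply: le_ereal_inf_tmp => _ [F _ <-]; exact: nneseries_ge0. Qed.

Let lebesgue_outer0 : lebesgue_outer set0 = 0.
Proof.
apply/eqP; rewrite eq_le lebesgue_outer_ge0 andbT.
apply: ereal_inf_lbound; exists (fun=> (0%R, 0%R)) => //.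
apply: eseries0 => k _ _; rewrite /box_volume big_ord_recl/= !mxE subr0 maxxx.
by rewrite mul0r.
Qed.

Let le_lebesgue_outer : {homo lebesgue_outer : A B / A `<=` B >-> A <= B}.
Proof.
move=> A B AB; apply/ereal_inf_le_tmp => _ [F BF <-].
by exists F => //; exact: subset_trans AB BF.
Qed.

Let lebesgue_outer_sigma_subadditive : sigma_subadditive lebesgue_outer.
Proof.
move=> A; have [[i ioo]|] := pselect (exists i, lebesgue_outer (A i) = +oo).
  rewrite (eseries_pinfty _ _ ioo) ?leey// => k _.
  by rewrite -ltNye (lt_le_trans _ (lebesgue_outer_ge0 _)).
rewrite -forallNE => Aoo.
suff add2e (e : {posnum R}) : lebesgue_outer (\bigcup_k A k) <=
    \sum_(i <oo) lebesgue_outer (A i) + e%:num%:E.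
  by apply/lee_addgt0Pr => _/posnumP[].
apply: le_trans (epsilon_trick (e := e%:num) xpredT _ _) => //.
pose vol p := (box_volume p)%:E.
pose P k F := A k `<=` \bigcup_j box (F j) /\
  \sum_(j <oo) vol (F j) <= lebesgue_outer (A k) + (e%:num / (2 ^ k.+1)%:R)%:E.
have [G PG] : {G : nat -> nat -> E * E & forall k, P k (G k)}.
  apply: (@choice _ _ P) => k; rewrite /P /lebesgue_outer.
  set S := (X in ereal_inf X); move infS : (ereal_inf S) => iS.
  case: iS infS => [r Sr|Soo|Soo].
  - have en1 : (0 < e%:num / (2 ^ k.+1)%:R)%R by [].
    have /(lb_ereal_inf_adherent en1) : ereal_inf S \is a fin_num by rewrite Sr.
    move=> [x [F AF Fx] xS].
    by exists F; split => //; rewrite Fx -Sr; exact/ltW.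
  - by have := Aoo k; rewrite /lebesgue_outer Soo.
  - by have := lebesgue_outer_ge0 (A k); rewrite /lebesgue_outer Soo.
have volG_ge0 x : 0 <= (vol \o uncurry G) x by exact: vol_ge0.
apply: (@le_trans _ _ (\esum_(i in setT) (vol \o uncurry G) i)).
  apply: ereal_inf_lbound => /=.
  have /card_esym/ppcard_eqP[f] := card_nat2.
  exists (uncurry G \o f).
    move=> t [i _ /(PG i).1[j _ Gijt]].
    by exists (f^-1%FUN (i, j)) => //=; rewrite invK ?inE.
  rewrite -(esum_pred_image (vol \o uncurry G) _ xpredT) ?[fun=> _]set_true//.
  by rewrite image_eq.
have -> : \esum_(i in setT) (vol \o uncurry G) i =
    \sum_(i <oo) \sum_(j <oo) vol (G i j).
  pose J : nat -> set (nat * nat) := fun i => [set (i, j) | j in setT].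
  have -> : setT = \bigcup_k J k.
    by rewrite predeqE => -[a b]; split => // _; exists a => //; exists b.
  rewrite esum_bigcupT /=; last 2 first.
    - apply/trivIsetP => i j _ _ ij.
      rewrite predeqE => -[k m] /=; split => //= -[] [_] _ [<-{k} _].
      by move=> [m' _] [] /esym/eqP; rewrite (negbTE ij).
    - by move=> /= [k m]; exact: vol_ge0.
  rewrite -(image_id [set: nat]) -fun_true esum_pred_image//; last first.
    by move=> k _; apply: esum_ge0 => p _; exact: vol_ge0.
  apply: eq_eseriesr => /= j _.
  rewrite -(esum_pred_image (vol \o uncurry G) (pair j) predT)//=; last 2 first.
    - by move=> p _; exact: vol_ge0.
    - by move=> ? ? _ _; exact: (@can_inj _ _ _ snd).
  by congr esum; rewrite predeqE => -[a b]; split; move=> [i _ <-]; exists i.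
apply: lee_lim.
- apply: is_cvg_nneseries => k *.
  by apply: nneseries_ge0 => m *; exact: (volG_ge0 (k, m)).
- by apply: is_cvg_nneseries => k *; apply: adde_ge0.
- by near=> k; apply: lee_sum => i _; exact: (PG i).2.
Unshelve. all: by end_near. Qed.

HB.instance Definition _ := isOuterMeasure.Build R E lebesgue_outer
  lebesgue_outer0 lebesgue_outer_ge0 le_lebesgue_outer
  lebesgue_outer_sigma_subadditive.

End lebesgue_outer_measure.

(* R^(n.+1) with the sigma-algebra of Lebesgue (i.e. Caratheodory) measurable
   sets, rather than the Borel sets only. *)
Definition euclid (R : realType) (n : nat) : Type :=
  caratheodory_type (@lebesgue_outer R n).

HB.instance Definition _ (R : realType) (n : nat) :=
  Measurable.copy (euclid R n) (caratheodory_type (@lebesgue_outer R n)).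

Definition lebesgue (R : realType) (n : nat) : set (euclid R n) -> \bar R :=
  @lebesgue_outer R n.

HB.instance Definition _ (R : realType) (n : nat) :=
  isMeasure.Build _ (euclid R n) R (@lebesgue R n)
    (@caratheodory_measure0 _ _ (@lebesgue_outer R n))
    (@caratheodory_measure_ge0 _ _ (@lebesgue_outer R n))
    (@caratheodory_measure_sigma_additive _ _ (@lebesgue_outer R n)).

(* A function on [0, +oo[ is represented by a total function, of which only the
   values at nonnegative arguments matter. *)
Section function_classes.
Context {R : realType}.
Implicit Types psi phi : R -> R.

Definition class_S psi : Prop :=
  [/\ forall s, 0 <= s -> 0 <= psi s,
      forall s t, 0 <= s -> s <= t -> psi s <= psi t,
      psi 0 = 0 /\ (forall s, 0 < s -> 0 < psi s),
      psi s @[s --> 0^'+] --> (0 : R)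
    & psi s @[s --> +oo] --> +oo].

Definition Delta2 phi : Prop :=
  exists2 L : R, 0 < L & forall s, 0 <= s -> phi (2 * s) <= L * phi s.

Definition class_Phi phi : Prop :=
  (exists2 psi, class_S psi & forall s, 0 <= s ->
     (phi s)%:E = (\int[lebesgue_measure]_(r in `[0%R, s]) (psi r)%:E)%E) /\
  Delta2 phi.

(* One-sided derivatives of phi, set to 0 at 0; for phi in [class_Phi] the
   limits exist at every s > 0, so that the total operator [lim] is meaningful
   there. *)
Definition psi_minus phi (s : R) : R :=
  if s == 0 then 0 else lim ((phi (s + h) - phi s) / h @[h --> 0^'-]).

Definition psi_plus phi (s : R) : R :=
  if s == 0 then 0 else lim ((phi (s + h) - phi s) / h @[h --> 0^'+]).

End function_classes.

Section best_approximation.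
Context {R : realType} {n : nat}.
Local Notation E := (euclid R n).
Local Notation pol := (mpoly.mpoly n.+1 R).
Implicit Types (Omega : set E) (f : E -> R) (phi : R -> R).

(* [mpoly.mmeasure mpoly.mdeg P] is [msize P], one plus the total degree of P
   (and 0 for P = 0). *)
Definition Pi_space (m : nat) : set pol :=
  [set P | (mpoly.mmeasure mpoly.mdeg P <= m.+1)%N].

Definition peval (P : pol) (x : E) : R :=
  mpoly.meval (fun i => (x : 'rV[R]_n.+1) ord0 i) P.

Definition L_psi_plus phi Omega : set (E -> R) :=
  [set f : E -> R | measurable_fun Omega f /\
    (\int[@lebesgue R n]_(x in Omega) (psi_plus phi `|f x|)%:E < +oo)%E].

Definition mu_psi_plus phi Omega (m : nat) f : set pol :=
  [set P | Pi_space m P /\ forall Q, Pi_space m Q ->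
    let p := peval P in let q := peval Q in
    let I (psi : R -> R) (A : set E) :=
      (\int[@lebesgue R n]_(x in Omega `&` A)
         (psi `|f x - p x| * `|q x|)%:E)%E in
    (I (psi_minus phi) ([set x | (f x > p x)%R] `&` [set x | (q x > 0)%R])
     + I (psi_minus phi) ([set x | (f x < p x)%R] `&` [set x | (q x < 0)%R])
     <=
     I (psi_plus phi) ([set x | (f x < p x)%R] `&` [set x | (q x > 0)%R])
     + I (psi_plus phi) ([set x | (f x > p x)%R] `&` [set x | (q x < 0)%R]))%E].

End best_approximation.

(* Main.v *)
(* With g u = phi `|u|, convexity and Delta2 bound `|g (u - q) - g u| by
   psi_plus (`|u| + `|q|) * `|q|, so that the renormalised energy
     J P = \int_Omega (g (f - P) - g f)
   is finite although phi `|f| need not be integrable. J is continuous and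
   coercive on the finite-dimensional space of polynomials, so it has a
   minimiser P; by dominated convergence the derivative of J at P in the
   direction of any Q is nonnegative, and this is exactly the inequality defining
   mu_psi_plus. If P1 and P2 both satisfy it, adding the inequalities for
   (P1, P2 - P1) and (P2, P1 - P2) contradicts the strict monotonicity of the
   one-sided derivatives of g unless P1 = P2 almost everywhere on Omega. A
   nonzero polynomial has a null zero set: if P vanishes on a set A of positive
   finite measure, infinitely many translates of A along e_i share a set B of
   positive measure, so P vanishes on every e_i-line through B, hence so does
   its i-th partial derivative on B, and one concludes by induction on degree. *)
Require Import Defs.
From HB Require Import structures.
From mathcomp Require Import all_boot all_order all_algebra.
From mathcomp Require Import all_classical all_reals all_analysis.
From mathcomp Require Import(canonicals,coercions) mpoly.
From mathcomp Require Import measurable_realfun ring lra.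

Set Implicit Arguments.
Unset Strict Implicit.
Unset Printing Implicit Defensive.

Import Order.TTheory GRing.Theory Num.Theory.
Import numFieldNormedType.Exports.

Local Open Scope classical_set_scope.
Local Open Scope ring_scope.

(** * Lebesgue measure on R^d *)

Section lebesgue_measure_facts.
Context {R : realType} {n : nat}.
Local Notation E := 'rV[R]_n.+1.
Implicit Types (p : E * E) (A : set E) (F : nat -> E * E) (v : E) (i : 'I_n.+1).

Lemma box_volume_ge0 p : (0 <= (box_volume p)%:E)%E.
Proof. by rewrite lee_fin prodr_ge0// => i _; rewrite le_max lexx. Qed.

Lemma lebesgue_outer_box p : (lebesgue_outer (box p) <= (box_volume p)%:E)%E.
Proof.
pose F k := if k is 0 then p else (0, 0) : E * E.
apply: ereal_inf_lbound; exists F; first by move=> x px; exists 0%N.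
rewrite nneseries_recl//=; last by move=> k _; exact: box_volume_ge0.
rewrite eseries0 ?adde0// => -[//|k] _ _ /=.
by rewrite /box_volume big_ord_recl/= !mxE subr0 maxxx mul0r.
Qed.

(** * Cutting boxes along coordinate hyperplanes *)

Definition set_coord i (r : R) v : E := \row_j (if j == i then r else v ord0 j).

(** [box_below] and [box_above] are the two halves of a box cut by the hyperplane [x_i = c]. If [c]
    falls outside the [i]-th side, one half degenerates and has volume 0 thanks to the truncation in
    [box_volume]. *)
Definition box_below i (c : R) p : E * E :=
  (p.1, set_coord i (Num.min (p.2 ord0 i) c) p.2).

Definition box_above i (c : R) p : E * E :=
  (set_coord i (Num.max (p.1 ord0 i) c) p.1, p.2).

Lemma boxI_below i c p x : box p x -> x ord0 i < c -> box (box_below i c p) x.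
Proof.
move=> px xc j /=; have /andP[a b] := px j.
rewrite !mxE a/=; case: eqVneq => [ji|//].
by rewrite lt_min -ji b ji xc.
Qed.

Lemma boxI_above i c p x : box p x -> c <= x ord0 i -> box (box_above i c p) x.
Proof.
move=> px xc j /=; have /andP[a b] := px j.
rewrite !mxE b andbT; case: eqVneq => [ji|//].
by rewrite ge_max -ji a ji xc.
Qed.

Lemma box_volume_split i c p :
  box_volume (box_below i c p) + box_volume (box_above i c p) = box_volume p.
Proof.
rewrite /box_volume (bigD1 i)//= [X in _ + X](bigD1 i)//= [RHS](bigD1 i)//=.
rewrite !mxE eqxx.
rewrite (eq_bigr (fun j => Num.max 0 (p.2 ord0 j - p.1 ord0 j))); last first.
  by move=> j /negbTE ji; rewrite !mxE ji.
rewrite [X in _ + _ * X](eq_bigr (fun j => Num.max 0 (p.2 ord0 j - p.1 ord0 j)));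
  last by move=> j /negbTE ji; rewrite !mxE ji.
rewrite -mulrDl; congr (_ * _).
set a := p.1 _ _; set b := p.2 _ _; rewrite /Num.max /Num.min.
by case: (ltP b c) => ?; case: (ltP a c) => ?;
  repeat (case: ifPn; rewrite -?leNgt => ?); lra.
Qed.

(** Cutting every box of a cover of [X] by the hyperplane gives covers of both parts of [X], with
    the same total volume by [box_volume_split]. *)
Lemma caratheodory_halfspace i (c : R) :
  caratheodory_measurable (@lebesgue_outer R n) [set x : E | x ord0 i < c].
Proof.
apply: le_caratheodory_measurable => X.
apply: le_ereal_inf_tmp => _ [F XF <-].
rewrite (eq_eseriesr (g := fun k => ((box_volume (box_below i c (F k)))%:E +
   (box_volume (box_above i c (F k)))%:E)%E)); last first.
  by move=> k _; rewrite -EFinD box_volume_split.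
rewrite nneseriesD; try by move=> *; exact: box_volume_ge0.
apply: leeD; apply: ereal_inf_lbound.
  exists (box_below i c \o F) => // x [/XF[k _ Fx] xc].
  by exists k => //; exact: boxI_below.
exists (box_above i c \o F) => // x [/XF[k _ Fx] xc].
by exists k => //; apply: boxI_above => //; rewrite leNgt; apply/negP.
Qed.

(** The rays []-oo, r[] generate the Borel sets of the line, and their preimages are the half-spaces
    above. *)
Lemma measurable_coord i (D : set (euclid R n)) :
  measurable_fun D (fun x : euclid R n => (x : E) ord0 i).
Proof.
apply: (@measurable_funS _ _ _ _ setT) => //.
apply: (measurability (@RGenInftyO.G R)) => [|/= _ [_] [r] -> <-].
  exact: RGenInftyO.measurableE.
rewrite setTI; have := caratheodory_halfspace i r.
by congr (caratheodory_measurable _ _); apply/seteqP; split => x /=;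
  rewrite in_itv.
Qed.

(** * Translation invariance of the outer measure and of measurability *)

Lemma lebesgue_outer_translate_le v A :
  (lebesgue_outer [set x | A (x - v)%R] <= lebesgue_outer A)%E.
Proof.
apply: le_ereal_inf_tmp => _ [F AF <-].
apply: ereal_inf_lbound; exists (fun k => ((F k).1 + v, (F k).2 + v)).
  move=> x /AF[k _ Fx]; exists k => // i; have := Fx i; rewrite !mxE/=.
  by rewrite lerBrDr ltrBlDr.
apply: eq_eseriesr => k _; congr (_%:E); apply: eq_bigr => i _ /=.
by rewrite !mxE opprD addrACA subrr addr0.
Qed.

Lemma lebesgue_outer_translate v A :
  lebesgue_outer [set x | A (x - v)] = lebesgue_outer A.
Proof.
apply/eqP; rewrite eq_le lebesgue_outer_translate_le/=.
have := lebesgue_outer_translate_le (- v) [set x | A (x - v)].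
by congr (lebesgue_outer _ <= _)%E; apply/seteqP; split => x /=;
  rewrite opprK addrK.
Qed.

(** Testing the translate of [A] against [X] amounts to testing [A] against [X] shifted by [- v],
    and the outer measure does not see the shift. *)
Lemma caratheodory_translate v A :
  caratheodory_measurable (@lebesgue_outer R n) A ->
  caratheodory_measurable (@lebesgue_outer R n) [set x | A (x - v)].
Proof.
move=> mA X; have := mA [set x | X (x + v)].
have e (B : set E) : lebesgue_outer [set x | B (x + v)] = lebesgue_outer B.
  by rewrite -[RHS](lebesgue_outer_translate (- v)) opprK.
rewrite e => ->; rewrite -(e (X `&` [set x | _])) -(e (X `&` ~` _)).
by congr (_ + _)%E; congr lebesgue_outer; apply/seteqP; split => x /=;
  rewrite addrK.
Qed.

Lemma bounded_setP A : bounded_set A <->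
  exists M : R, forall x, A x -> forall i, `|x ord0 i| <= M.
Proof.
split=> [[M [Mr AM]]|[M AM]].
  exists (M + 1) => x Ax i; have := AM (M + 1) (ltr_pwDr ltr01 (lexx _)) x Ax.
  apply: le_trans; rewrite [leRHS]/Num.norm /= mx_normrE.
  by apply: le_trans (le_bigmax _ _ (ord0, i)).
exists M; split; first exact: num_real.
move=> N MN x Ax; rewrite /Num.norm/= mx_normrE; apply/bigmax_leP; split.
  by apply: le_trans (ltW MN); exact: le_trans (normr_ge0 _) (AM x Ax ord0).
by case=> a b _ /=; rewrite (ord1 a) (le_trans (AM _ Ax _))// ltW.
Qed.

Lemma bounded_lebesgue_fin A : bounded_set A -> (lebesgue_outer A < +oo)%E.
Proof.
move=> /bounded_setP[M AM].
(* The upper corner is [M + 1] because boxes exclude their upper faces. *)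
apply: le_lt_trans (ltry (box_volume (const_mx (- M), const_mx (M + 1)))).
apply: le_trans (lebesgue_outer_box _); apply: le_outer_measure => x Ax i.
have := AM _ Ax i; rewrite !mxE ler_norml => /andP[-> /=] /le_lt_trans; apply.
by rewrite ltrDl.
Qed.

End lebesgue_measure_facts.

(** * Zero sets of polynomials *)

Section polynomials.
Context {R : realType} {n : nat}.
Local Notation E := (euclid R n).
Local Notation pol := (mpoly.mpoly n.+1 R).
Local Notation mnm := (mpoly.multinom n.+1).
Implicit Types (P Q : pol) (m : mnm) (x v : 'rV[R]_n.+1) (i : 'I_n.+1) (A : set E).

Lemma pevalE P x : peval P x = \sum_(m <- mpoly.msupp P)
  mpoly.mcoeff m P * \prod_i x ord0 i ^+ (m i).
Proof. by rewrite /peval mpoly.mevalE. Qed.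

Lemma measurable_peval P (D : set E) : measurable_fun D (peval P).
Proof.
rewrite (_ : peval P = fun x : E => \sum_(m <- mpoly.msupp P)
  mpoly.mcoeff m P * \prod_i (x : 'rV__) ord0 i ^+ (m i)); last first.
  by apply/funext => x; exact: pevalE.
apply: measurable_sum => m; apply: measurable_funM => //.
apply: measurable_prod => i _; apply: measurable_funX.
exact: measurable_coord.
Qed.

Lemma measurable_translate v A : measurable A ->
  measurable ([set x : 'rV[R]_n.+1 | A (x - v)] : set E).
Proof. exact: caratheodory_translate. Qed.

(** [B] is the limsup of the translates of [A] by [e_i / (k + 1)]. Each tail union contains a
    translate of [A], hence has at least the measure of [A]; the tails decrease inside a bounded
    set, so continuity from above passes this bound to their intersection. *)
Lemma limsup_translates A i :
  measurable A -> bounded_set (A : set 'rV[R]_n.+1) -> (0 < lebesgue A)%E ->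
  exists B : set E, [/\ measurable B, bounded_set (B : set 'rV[R]_n.+1),
    (0 < lebesgue B)%E & forall x, B x -> forall N, exists2 k, (N <= k)%N &
      A ((x : 'rV__) - k.+1%:R^-1 *: delta_mx ord0 i)].
Proof.
move=> mA bA A0.
pose S k : set E := [set x : 'rV__ | A (x - k.+1%:R^-1 *: delta_mx ord0 i)].
pose F N : set E := \bigcup_(k >= N) S k.
have mS k : measurable (S k) by exact: measurable_translate.
have mF N : measurable (F N) by apply: bigcup_measurable.
have bF : bounded_set (F 0%N : set 'rV[R]_n.+1).
  have /bounded_setP[M AM] := bA; apply/bounded_setP.
  exists (M + 1) => x [k _ /AM Skx] j; have := Skx j; rewrite !mxE.
  set a := x _ _; set b := k.+1%:R^-1 * _ => ab.
  rewrite -(subrK b a) (le_trans (ler_normD _ _))// lerD// /b eqxx/=.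
  rewrite normrM ger0_norm ?invr_ge0// normr_nat.
  rewrite mulr_ile1// ?invf_le1 ?ler1n ?ltr0n//.
  by case: (j == i).
have Foo : (lebesgue (F 0%N) < +oo)%E by exact: bounded_lebesgue_fin.
exists (\bigcap_N F N); split.
- exact: bigcapT_measurable.
- have /bounded_setP[M FM] := bF; apply/bounded_setP; exists M => x Fx.
  by apply: FM; exact: Fx 0%N I.
- apply: lt_le_trans A0 _.
  have cvF : lebesgue (F N) @[N --> \oo] --> lebesgue (\bigcap_N F N).
    apply: nonincreasing_cvg_mu => //; first exact: bigcapT_measurable.
    move=> k l kl; apply/subsetPset => x [j /= lj Sj]; exists j => //=.
    exact: leq_trans lj.
  move/cvg_lim : (cvF) => <-//; apply: lime_ge.
    by apply/cvg_ex; eexists; exact: cvF.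
  near=> N; rewrite -[leLHS](lebesgue_outer_translate (N.+1%:R^-1 *: delta_mx ord0 i)).
  by apply: le_outer_measure => x Sx; exists N => //=.
- by move=> x Bx N; have [k /= Nk Sk] := Bx N I; exists k.
Unshelve. all: by end_near. Qed.

(** The univariate polynomial [t |-> P (x + t e_i)], centred at [x] so that its derivative at 0 is
    the [i]-th partial derivative of [P] at [x]. *)
Definition line_poly P x i : {poly R} := \sum_(m <- mpoly.msupp P)
  (mpoly.mcoeff m P * \prod_(j | j != i) x ord0 j ^+ m j)%:P *
  ('X + (x ord0 i)%:P) ^+ m i.

Lemma horner_line_poly P x i t :
  (line_poly P x i).[t] = peval P (x + t *: delta_mx ord0 i).
Proof.
rewrite pevalE horner_sum; apply: eq_bigr => m _.
rewrite [in RHS](bigD1 i)//= hornerM hornerC horner_exp hornerD hornerX hornerC.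
rewrite !mxE !eqxx/=.
rewrite mulr1 -mulrA; congr (_ * _); rewrite mulrC addrC; congr (_ * _).
by apply: eq_bigr => j /negbTE ji; rewrite !mxE ji andbF mulr0 addr0.
Qed.

Lemma deriv_line_poly P x i :
  (line_poly P x i)^`().[0] = peval (mpoly.mderiv i P) x.
Proof.
rewrite raddf_sum horner_sum /peval /mpoly.mderiv raddf_sum.
apply: eq_bigr => m _ /=.
rewrite mpoly.mevalZ mpoly.mevalX derivM derivC mul0r add0r.
rewrite deriv_exp derivD derivX derivC addr0.
rewrite mul1r hornerM hornerC hornerMn horner_exp hornerD hornerX hornerC add0r.
rewrite [in RHS](bigD1 i)//= mpoly.mnmBE mpoly.mnm1E eqxx subn1.
rewrite [in RHS](eq_bigr (fun j => x ord0 j ^+ m j)); last first.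
  by move=> j /negbTE ji; rewrite mpoly.mnmBE mpoly.mnm1E eq_sym ji subn0.
by rewrite -mulr_natl; ring.
Qed.

(** Infinitely many of the distinct numbers [- 1 / (k + 1)] are roots, whereas a nonzero univariate
    polynomial has fewer roots than its size. *)
Lemma line_poly_eq0 P x i :
  (forall N, exists2 k, (N <= k)%N &
     peval P (x - k.+1%:R^-1 *: delta_mx ord0 i) = 0) -> line_poly P x i = 0.
Proof.
move=> Pt; pose t k : R := - k.+1%:R^-1.
have t_inj : injective t.
  by move=> a b /oppr_inj/invr_inj/eqP; rewrite eqr_nat => /eqP[].
have roots L : exists2 s, uniq s & size s = L /\
    all (fun k => root (line_poly P x i) (t k)) s.
  elim: L => [|L [s us [<- rs]]]; first by exists [::].
  (* Taking [k] above every index already listed makes the new root distinct from the earlier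
     ones. *)
  have [k sk Pk] := Pt (\max_(k <- s) k).+1.
  exists (k :: s) => /=; rewrite ?us ?rs ?andbT.
    apply/negP => ks; have := @leq_bigmax_seq _ s xpredT id k ks isT.
    by rewrite leqNgt sk.
  by split => //; rewrite /root horner_line_poly /t scaleNr Pk.
apply/eqP; apply: contraT => p0.
have [s us [sE rs]] := roots (size (line_poly P x i)).
have := max_poly_roots (rs := map t s) p0.
by rewrite map_inj_uniq// us size_map sE ltnn all_map; apply.
Qed.

(** A monomial [m] of the derivative comes from the monomial [m + e_i] of [P], whose degree is one
    larger. *)
Lemma msize_mderiv k P i : (mpoly.mmeasure mpoly.mdeg P <= k.+1)%N ->
  (mpoly.mmeasure mpoly.mdeg (mpoly.mderiv i P) <= k)%N.
Proof.
move=> Pk; rewrite mpoly.mmeasureE; apply/bigmax_leqP_seq => m + _.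
rewrite mpoly.mcoeff_msupp mpoly.mcoeff_deriv => Pm.
rewrite -ltnS (leq_trans _ Pk)//.
have -> : (mpoly.mdeg m).+2 = (mpoly.mdeg (mpoly.mnm_add m (mpoly.mnm1 i))).+1.
  by rewrite mpoly.mdegD mpoly.mdeg1 addn1.
apply: mpoly.msize_mdeg_lt; rewrite mpoly.mcoeff_msupp.
by apply: contra_neq Pm => ->; rewrite mul0rn.
Qed.

(** If [m_i > 0], the coefficient of [m - e_i] in the [i]-th derivative is [m_i] times that of [m]
    in [P], and a positive integer factor can be cancelled in [R]. *)
Lemma mpoly_mderiv_eq0 P : (forall i, mpoly.mderiv i P = 0) ->
  P = mpoly.mpolyC n.+1 (mpoly.mcoeff (mpoly.mnm0) P).
Proof.
move=> P0; apply/mpoly.mpolyP => m; rewrite mpoly.mcoeffC.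
have [->|m0] := eqVneq m mpoly.mnm0; first by rewrite mulr1.
have [i mi] : exists i, m i != 0%N.
  apply/existsP; apply: contraNT m0; rewrite negb_exists => /forallP mi.
  by apply/eqP/mpoly.mnmP => i; have := mi i; rewrite negbK mpoly.mnm0E => /eqP.
have := congr1 (mpoly.mcoeff (mpoly.mnm_sub m (mpoly.mnm1 i))) (P0 i).
rewrite mpoly.mcoeff_deriv mpoly.mcoeff0 mpoly.submK ?mpoly.lep1mP// => /eqP.
by rewrite mulrn_eq0/= mulr0 => /eqP.
Qed.

Lemma mpoly_eq0_pos_measure P A : measurable A ->
  bounded_set (A : set 'rV[R]_n.+1) -> (0 < lebesgue A)%E ->
  (forall x, A x -> peval P x = 0) -> P = 0.
Proof.
have [k] := ubnP (mpoly.mmeasure mpoly.mdeg P).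
(* The set [A] varies in the induction, since the derivatives are only known to vanish on another
   set [B]. *)
elim: k P A => // k IH P A /=; rewrite ltnS => Pk mA bA A0 PA.
have P1 i : mpoly.mderiv i P = 0.
  have [k0|k0] := posnP k.
    move: Pk; rewrite k0 leqn0 mpoly.mmeasure_poly_eq0 => /eqP ->.
    by rewrite mpoly.mderiv0.
  have [B [mB bB B0 BA]] := limsup_translates i mA bA A0.
  apply: (IH _ B) => //; first by rewrite -(prednK k0) ltnS msize_mderiv ?prednK.
  move=> x /BA xA; rewrite -deriv_line_poly.
  rewrite line_poly_eq0 ?deriv0 ?horner0// => N.
  by have [j Nj /PA] := xA N; exists j.
move: PA; rewrite (mpoly_mderiv_eq0 P1) => PA.
have /set0P[x Ax] : A != set0.
  by apply: contraTneq A0 => ->; rewrite measure0 ltxx.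
by have := PA x Ax; rewrite /peval mpoly.mevalC => ->; rewrite mpoly.mpolyC0.
Qed.

End polynomials.

(** * The convex function phi and its one-sided derivatives *)

Section convex_primitive.
Context {R : realType} (psi phi : R -> R).
Hypotheses (psiS : class_S psi)
  (phiE : forall s, 0 <= s ->
     (phi s)%:E = (\int[lebesgue_measure]_(r in `[0%R, s]) (psi r)%:E)%E).
Local Notation pp := (psi_plus phi).
Local Notation pm := (psi_minus phi).
Implicit Types (a b s t h u q : R).

Lemma psi_nd s t : 0 <= s -> s <= t -> psi s <= psi t.
Proof. by case: psiS => _ H _ _ _; exact: H. Qed.

Lemma psi_ge0 s : 0 <= s -> 0 <= psi s.
Proof. by case: psiS => H _ _ _ _; exact: H. Qed.

Lemma measurable_psi (D : set R) : D `<=` [set s | 0 <= s] -> measurable D ->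
  measurable_fun D (EFin \o psi).
Proof.
move=> D0 mD; apply/measurable_EFinP.
(* The values of [psi] at negative arguments are arbitrary; replacing them by [psi 0] gives a
   nondecreasing function on the whole line. *)
apply: (@eq_measurable_fun _ _ _ _ _ (fun s => psi (Num.max 0 s))).
  by move=> s /set_mem /D0 /= s0; rewrite max_r.
apply: nondecreasing_measurable => // s t st.
apply: psi_nd; first by rewrite le_max lexx.
by rewrite ge_max !le_max lexx st orbT.
Qed.

Lemma phi0 : phi 0 = 0.
Proof. by apply: EFin_inj; rewrite phiE// set_itv1 integral_set1. Qed.

Lemma phi_split a b : 0 <= a -> a <= b ->
  ((phi b)%:E = (phi a)%:E + \int[lebesgue_measure]_(r in `]a, b]) (psi r)%:E)%E.
Proof.
move=> a0 ab; rewrite !phiE// ?(le_trans a0)//.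
rewrite -ge0_integral_setU//=.
- congr (integral _ _ _); apply/seteqP; split => x/=; rewrite !in_itv/=.
    by move=> /andP[-> ->]; case: leP => _; [left|right].
  by move=> [/andP[-> /le_trans->]//|/andP[/ltW/(le_trans a0)-> ->]].
- apply: measurable_psi; last exact: measurableU.
  move=> x/= []; rewrite in_itv/= => /andP[]//.
  by move=> /ltW/(le_trans a0).
- move=> x []; rewrite /= in_itv/= lee_fin => /andP[x0 _]; apply: psi_ge0 => //.
  exact: le_trans (ltW x0).
- apply/disj_setPS => x/= []; rewrite !in_itv/= => /andP[_ xa] /andP[ax _].
  by move: (lt_le_trans ax xa); rewrite ltxx.
Qed.

(** On []a, b]] the integrand lies between [psi a] and [psi b]. The integral representation of [phi]
    enters the sequel only through this bound and [phi0]. *)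
Lemma phi_slope a b : 0 <= a -> a <= b ->
  psi a * (b - a) <= phi b - phi a <= psi b * (b - a).
Proof.
move=> a0 ab; have b0 := le_trans a0 ab; have := phi_split a0 ab.
set I := (\int[_]_(_ in _) _)%E => e.
have cst_int (c : R) :
    (\int[lebesgue_measure]_(r in `]a, b]) (cst c%:E r) = (c * (b - a))%:E)%E.
  rewrite integral_cst//= lebesgue_measure_itv/= lte_fin.
  case: ifPn => [_|]; first by rewrite -EFinD -EFinM.
  rewrite -leNgt => ba; have -> : a = b by apply: le_anti; rewrite ab ba.
  by rewrite subrr mulr0 mule0.
have IE : I = (phi b - phi a)%:E.
  by rewrite EFinB e addeAC subee// add0e.
have mI : measurable_fun `]a, b] (EFin \o psi).
  by apply: measurable_psi => // x/=; rewrite in_itv/= => /andP[/ltW/(le_trans a0)].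
rewrite -!lee_fin -IE -!cst_int; apply/andP; split.
  apply: ge0_le_integral => //= x; rewrite in_itv/= lee_fin => /andP[ax xb].
  - exact: psi_ge0.
  - by rewrite psi_nd// ltW.
apply: ge0_le_integral => //= x; rewrite in_itv/= lee_fin => /andP[ax xb].
- by rewrite psi_ge0// (le_trans a0)// ltW.
- by rewrite psi_nd// (le_trans a0)// ltW.
Qed.

Lemma phi_nd a b : 0 <= a -> a <= b -> phi a <= phi b.
Proof.
move=> a0 ab; have /andP[+ _] := phi_slope a0 ab; rewrite -(subr_ge0 (phi a)).
by apply: le_trans; rewrite mulr_ge0 ?psi_ge0// subr_ge0.
Qed.

Lemma phi_gt0 s : 0 < s -> 0 < phi s.
Proof.
(* The slope bound is applied from [s / 2], where [psi] is already positive; from 0 it would only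
   give [psi 0 = 0]. *)
move=> s0; have s20 : 0 < s / 2 by rewrite divr_gt0.
have /andP[+ _] : psi (s / 2) * (s - s / 2) <= phi s - phi (s / 2) <= psi s * (s - s / 2).
  by apply: phi_slope; lra.
have : 0 <= phi (s / 2) by rewrite -phi0 phi_nd// ltW.
have [_ _ [_ /(_ _ s20) ps] _ _] := psiS.
have : 0 < psi (s / 2) * (s - s / 2) by rewrite mulr_gt0//; lra.
lra.
Qed.

Lemma phi_ge0 s : 0 <= s -> 0 <= phi s.
Proof. by move=> s0; rewrite -phi0 phi_nd. Qed.

(** Three-slope inequality: [psi (s + h)] separates the slope of [phi] on [[s, s + h]] from its
    slope on [[s + h, s + h']]. *)
Lemma slope_right_nd s h h' : 0 <= s -> 0 < h -> h <= h' ->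
  (phi (s + h) - phi s) / h <= (phi (s + h') - phi s) / h'.
Proof.
move=> s0 h0 hh; have h'0 := lt_le_trans h0 hh.
rewrite ler_pdivrMr// mulrAC ler_pdivlMr//.
have /andP[_ A] : psi s * (s + h - s) <= phi (s + h) - phi s <= psi (s + h) * (s + h - s).
  by apply: phi_slope; lra.
have /andP[B _] : psi (s + h) * (s + h' - (s + h)) <= phi (s + h') - phi (s + h)
   <= psi (s + h') * (s + h' - (s + h)).
  by apply: phi_slope; lra.
have := ler_wpM2r (ltW h0) B.
have : (h' - h) * (phi (s + h) - phi s) <= (h' - h) * (psi (s + h) * (s + h - s)).
  by rewrite ler_wpM2l// subr_ge0.
nra.
Qed.

Lemma slope_left_nd s h h' : 0 < h -> h <= h' -> h' <= s ->
  (phi s - phi (s - h')) / h' <= (phi s - phi (s - h)) / h.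
Proof.
move=> h0 hh hs; have h'0 := lt_le_trans h0 hh.
rewrite ler_pdivrMr// mulrAC ler_pdivlMr//.
have /andP[A _] : psi (s - h) * (s - (s - h)) <= phi s - phi (s - h)
    <= psi s * (s - (s - h)).
  by apply: phi_slope; lra.
have /andP[_ B] : psi (s - h') * (s - h - (s - h')) <= phi (s - h) - phi (s - h')
   <= psi (s - h) * (s - h - (s - h')).
  by apply: phi_slope; lra.
have := ler_wpM2r (ltW h0) B.
have : (h' - h) * (psi (s - h) * (s - (s - h))) <= (h' - h) * (phi s - phi (s - h)).
  by rewrite ler_wpM2l// subr_ge0.
nra.
Qed.

(** The slopes are monotone in [h] and bounded below by 0. At [s = 0] they lie between 0 and
    [psi h], which tends to 0, so the limit agrees with the value imposed in [psi_plus]. *)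
Lemma slope_right_cvg s : 0 <= s ->
  (phi (s + h) - phi s) / h @[h --> 0^'+] --> pp s.
Proof.
rewrite le_eqVlt => /predU1P[<-|s0].
  rewrite /psi_plus eqxx; have [_ _ _ ps0 _] := psiS.
  apply: (@squeeze_cvgr _ _ _ _ (fun=> 0) psi) => //; last exact: cvg_cst.
  near=> h; have h0 : 0 < h by [].
  rewrite add0r phi0 subr0; apply/andP; split.
    by rewrite divr_ge0 ?phi_ge0 ?ltW.
  rewrite ler_pdivrMr//; have /andP[_] := phi_slope (lexx 0) (ltW h0).
  by rewrite phi0 !subr0.
rewrite /psi_plus gt_eqF//.
suff : cvg ((phi (s + h) - phi s) / h @[h --> 0^'+]) by [].
apply: nondecreasing_at_right_is_cvgr.
  near=> x => h h'; rewrite !in_itv/= => /andP[h0 _] _.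
  by apply: slope_right_nd => //; exact: ltW.
apply: nearW => x; exists 0 => y [h /=]; rewrite in_itv/= => /andP[h0 _] <-.
rewrite divr_ge0 ?subr_ge0 ?(ltW h0)// phi_nd ?(ltW s0)//.
by rewrite lerDl (ltW h0).
Unshelve. all: by end_near. Qed.

Lemma slope_left_cvg s : 0 < s ->
  (phi (s + h) - phi s) / h @[h --> 0^'-] --> pm s.
Proof.
move=> s0; rewrite /psi_minus gt_eqF//.
suff : cvg ((phi (s + h) - phi s) / h @[h --> 0^'-]) by [].
have e h : (phi (s + h) - phi s) / h = (phi s - phi (s - - h)) / - h.
  by rewrite opprK invrN mulrN -mulNr opprB.
apply: nondecreasing_at_left_is_cvgr.
  (* Here [x] is close enough to 0 that [s + h] stays nonnegative, where [phi] is controlled. *)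
  near=> x => h h'; rewrite !in_itv/= => /andP[xh h0] /andP[xh' h'0] hh.
  rewrite !e; apply: slope_left_nd; rewrite ?oppr_gt0 ?lerN2//.
  rewrite lerNl (le_trans _ (ltW xh))//; near: x; apply: nbhs_left_ge.
  by rewrite oppr_lt0.
near=> x; have sx : - s < x by near: x; apply: nbhs_left_gt; rewrite oppr_lt0.
exists (psi s) => y [h /=]; rewrite in_itv/= => /andP[xh h0] <-.
have /andP[_] : psi (s + h) * (s - (s + h)) <= phi s - phi (s + h)
    <= psi s * (s - (s + h)).
  by apply: phi_slope; lra.
by rewrite e opprK ler_pdivrMr ?oppr_gt0// opprD addrA subrr add0r.
Unshelve. all: by end_near. Qed.

Lemma pp_slope a b : 0 <= a -> a <= b -> pp a * (b - a) <= phi b - phi a.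
Proof.
move=> a0; rewrite le_eqVlt => /predU1P[<-|ab]; first by rewrite !subrr mulr0.
rewrite -ler_pdivlMr ?subr_gt0//.
apply: (cvgr_to_le (slope_right_cvg a0)); near=> h.
have := @slope_right_nd a h (b - a) a0; rewrite subrKC; apply => //.
by near: h; apply: nbhs_right_le; rewrite subr_gt0.
Unshelve. all: by end_near. Qed.

Lemma pm_slope a b : 0 <= a -> a <= b -> 0 < b ->
  phi b - phi a <= pm b * (b - a).
Proof.
move=> a0; rewrite le_eqVlt => /predU1P[<-|ab] b0; first by rewrite !subrr mulr0.
rewrite -ler_pdivrMr ?subr_gt0//.
apply: (cvgr_to_ge (slope_left_cvg b0)); near=> h.
have -> : (phi (b + h) - phi b) / h = (phi b - phi (b - - h)) / - h.
  by rewrite opprK invrN mulrN -mulNr opprB.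
have := @slope_left_nd b (- h) (b - a); rewrite subKr; apply.
- by rewrite oppr_gt0.
- by rewrite lerNl opprB; near: h; apply: nbhs_left_ge; rewrite subr_lt0.
- by rewrite lerBlDr lerDl.
Unshelve. all: by end_near. Qed.

(** * Interlacing of [psi] with the one-sided derivatives, and their monotonicity *)

Lemma pp0 : pp 0 = 0. Proof. by rewrite /psi_plus eqxx. Qed.

Lemma pm0 : pm 0 = 0. Proof. by rewrite /psi_minus eqxx. Qed.

Lemma psi_le_pp s : 0 <= s -> psi s <= pp s.
Proof.
move=> s0; apply: (cvgr_to_ge (slope_right_cvg s0)); near=> h.
have h0 : 0 < h by [].
have /andP[+ _] : psi s * (s + h - s) <= phi (s + h) - phi s <= psi (s + h) * (s + h - s).
  by apply: phi_slope => //; rewrite lerDl ltW.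
by rewrite ler_pdivlMr// addrAC subrr add0r.
Unshelve. all: by end_near. Qed.

Lemma pp_le_psi s t : 0 <= s -> s < t -> pp s <= psi t.
Proof.
move=> s0 st; have := pp_slope s0 (ltW st).
have /andP[_ +] := phi_slope s0 (ltW st) => /[swap] /le_trans /[apply].
by rewrite ler_pM2r// subr_gt0.
Qed.

Lemma pm_le_psi s : 0 <= s -> pm s <= psi s.
Proof.
rewrite le_eqVlt => /predU1P[<-|s0]; first by rewrite pm0 psi_ge0.
apply: (cvgr_to_le (slope_left_cvg s0)); near=> h.
have h0 : h < 0 by [].
have sh : 0 <= s + h.
  by rewrite -lerBlDl sub0r; near: h; apply: nbhs_left_ge; rewrite oppr_lt0.
have /andP[_ +] : psi (s + h) * (s - (s + h)) <= phi s - phi (s + h)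
    <= psi s * (s - (s + h)).
  by apply: phi_slope => //; lra.
rewrite ler_ndivrMr//; lra.
Unshelve. all: by end_near. Qed.

Lemma psi_le_pm s t : 0 <= s -> s < t -> psi s <= pm t.
Proof.
move=> s0 st; have := pm_slope s0 (ltW st) (le_lt_trans s0 st).
have /andP[+ _] := phi_slope s0 (ltW st) => /le_trans /[apply].
by rewrite ler_pM2r// subr_gt0.
Qed.

Lemma pp_nd s t : 0 <= s -> s <= t -> pp s <= pp t.
Proof.
move=> s0; rewrite le_eqVlt => /predU1P[<-//|st].
by rewrite (le_trans (pp_le_psi s0 st))// psi_le_pp// (le_trans s0)// ltW.
Qed.

Lemma pm_nd s t : 0 <= s -> s <= t -> pm s <= pm t.
Proof.
move=> s0; rewrite le_eqVlt => /predU1P[<-//|st].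
by rewrite (le_trans (pm_le_psi s0))// psi_le_pm.
Qed.

Lemma pm_le_pp s : 0 <= s -> pm s <= pp s.
Proof. by move=> s0; rewrite (le_trans (pm_le_psi s0))// psi_le_pp. Qed.

Lemma pp_ge0 s : 0 <= s -> 0 <= pp s.
Proof. by move=> s0; rewrite (le_trans (psi_ge0 s0))// psi_le_pp. Qed.

Lemma pm_ge0 s : 0 <= s -> 0 <= pm s.
Proof. by move=> s0; rewrite -pm0 pm_nd. Qed.

Lemma measurable_nd_norm (g : R -> R) :
  (forall s t, 0 <= s -> s <= t -> g s <= g t) ->
  measurable_fun setT (fun u => g `|u|).
Proof.
move=> gnd; rewrite (_ : (fun u => _) =
    (fun u => g (Num.max 0 u)) \o (fun u : R => `|u|)).
  apply: measurableT_comp; last exact: normr_measurable.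
  apply: nondecreasing_measurable => // s t st.
  apply: gnd; first by rewrite le_max lexx.
  by rewrite ge_max !le_max lexx st orbT.
by apply/funext => u /=; rewrite max_r.
Qed.

(** Past a point [s0] with [K <= psi s0] the slopes of [phi] are at least [K]; before it,
    [K * (s - s0)] is nonpositive. Coercivity of the energy needs this for a prescribed [K]. *)
Lemma phi_superlinear (K : R) : 0 <= K ->
  exists2 C, 0 <= C & forall s, 0 <= s -> K * s - C <= phi s.
Proof.
move=> K0; have [_ _ _ _ /cvgryPge/(_ K)[M [_ MK]]] := psiS.
pose s0 := Num.max 0 M + 1.
have s00 : 0 <= s0 by rewrite addr_ge0// le_max lexx.
have Ks0 : K <= psi s0.
  by apply: MK; rewrite /s0 ltr_pwDr// le_max lexx orbT.
exists (K * s0); first exact: mulr_ge0.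
move=> s s_ge0; rewrite -mulrBr; have [ss0|s0s] := leP s s0.
  by apply: le_trans (phi_ge0 s_ge0); rewrite mulr_ge0_le0// subr_le0.
have /andP[+ _] := phi_slope s00 (ltW s0s).
have := phi_ge0 s00.
have : K * (s - s0) <= psi s0 * (s - s0) by rewrite ler_wpM2r// subr_ge0 ltW.
lra.
Qed.

(** * The doubling condition for the right derivative *)

Section delta2.
Hypothesis phiD : Delta2 phi.

(** Doubling passes from [phi] to [pp] with constant [L * L], since [2 s pp(2 s) <= phi(4 s) <= L^2
    phi(s) <= L^2 s pp(s)]. For [a <= b] it then suffices to bound [a + b] by [2 b]. *)
Lemma pp_quasi_subadd : exists2 K, 0 <= K &
  forall a b, 0 <= a -> 0 <= b -> pp (a + b) <= K * (pp a + pp b).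
Proof.
case: phiD => L L0 phiL; exists (L * L); first by rewrite mulr_ge0// ltW.
have dbl s : 0 <= s -> pp (2 * s) <= L * L * pp s.
  rewrite le_eqVlt => /predU1P[<-|s0]; first by rewrite mulr0 pp0 mulr0.
  have s20 : 0 <= 2 * s by rewrite mulr_ge0// ltW.
  have A : pp (2 * s) * (2 * (2 * s) - 2 * s) <= phi (2 * (2 * s)) - phi (2 * s).
    by apply: pp_slope => //; lra.
  have B := phiL _ s20.
  have C := ler_wpM2l (ltW L0) (phiL _ (ltW s0)).
  have /andP[_ D] := phi_slope (lexx 0) (ltW s0).
  have F : psi s * s <= pp s * s by rewrite ler_wpM2r ?psi_le_pp ?(ltW s0).
  have G : L * L * phi s <= L * L * (pp s * s).
    by rewrite ler_wpM2l ?mulr_ge0 ?(ltW L0)//; move: D; rewrite phi0 !subr0; lra.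
  have H : 0 <= pp (2 * s) * s by rewrite mulr_ge0 ?pp_ge0 ?(ltW s0).
  rewrite -(ler_pM2r s0) -mulrA.
  have := phi_ge0 s20; lra.
move=> a b a0 b0.
wlog ab : a b a0 b0 / a <= b.
  move=> W; have [|/ltW] := leP a b; first exact: W.
  by rewrite (addrC a) (addrC (pp a)); exact: W.
apply: (@le_trans _ _ (pp (2 * b))).
  by apply: pp_nd; [exact: addr_ge0|lra].
apply: le_trans (dbl _ b0) _; rewrite ler_wpM2l ?mulr_ge0 ?(ltW L0)//.
by rewrite lerDr pp_ge0.
Qed.

End delta2.


(** With [u = f - P] and [q = Q], [lower_part] and [upper_part] are the integrands of the left and
    right sides of the inequality in [mu_psi_plus]; the sign of [u * q] merges the two regions of
    each side. *)
Definition lower_part u q : R := if 0 < u * q then pm `|u| * `|q| else 0.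

Definition upper_part u q : R := if u * q < 0 then pp `|u| * `|q| else 0.

(* The right derivative at [t = 0] of [t |-> phi `|u - t * q|]. *)
Definition dir_deriv u q : R := upper_part u q - lower_part u q.

Lemma dir_derivNN u q : dir_deriv (- u) (- q) = dir_deriv u q.
Proof. by rewrite /dir_deriv /upper_part /lower_part !mulrNN !normrN. Qed.

Lemma lower_part_ge0 u q : 0 <= lower_part u q.
Proof. by rewrite /lower_part; case: ifP => // _; rewrite mulr_ge0 ?pm_ge0. Qed.

Lemma upper_part_ge0 u q : 0 <= upper_part u q.
Proof. by rewrite /upper_part; case: ifP => // _; rewrite mulr_ge0 ?pp_ge0. Qed.

Lemma lower_part_le u q : lower_part u q <= pp `|u| * `|q|.
Proof.
rewrite /lower_part; case: ifP => _; last by rewrite mulr_ge0 ?pp_ge0.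
by rewrite ler_wpM2r ?pm_le_pp.
Qed.

Lemma upper_part_le u q : upper_part u q <= pp `|u| * `|q|.
Proof.
by rewrite /upper_part; case: ifP => _ //; rewrite mulr_ge0 ?pp_ge0.
Qed.

Lemma dir_deriv_cvg u q :
  k.+1%:R * (phi `|u - k.+1%:R^-1 * q| - phi `|u|) @[k --> \oo] --> dir_deriv u q.
Proof.
have [->|q0] := eqVneq q 0.
  rewrite /dir_deriv /upper_part /lower_part mulr0 ltxx subr0.
  under eq_fun do rewrite mulr0 subr0 subrr mulr0.
  exact: cvg_cst.
wlog uq : u q q0 / 0 < u \/ u = 0 /\ q < 0.
  move=> W; case: (ltgtP u 0) => [u0|u0|u0].
  - rewrite -dir_derivNN; have := W (- u) (- q).
    rewrite oppr_eq0 oppr_gt0 => /(_ q0 (or_introl u0)).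
    by under eq_fun do rewrite mulrN -opprD !normrN.
  - by apply: W => //; left.
  - case: (ltgtP q 0) q0 => // q0 _.
      by apply: W; [rewrite lt_eqF|right].
    have := W (- u) (- q); rewrite dir_derivNN oppr_eq0 oppr_lt0 u0 oppr0.
    move=> /(_ (lt0r_neq0 q0) (or_intror (conj erefl q0))).
    by under eq_fun do rewrite mulrN opprK add0r -normrN -[- (_ * _)]sub0r.
have u0 : 0 <= u by case: uq => [/ltW//|[->]].
pose h k : R := - (k.+1%:R^-1 * q).
have hE k : k.+1%:R * (phi `|u - k.+1%:R^-1 * q| - phi `|u|) =
    - q * ((phi `|u + h k| - phi u) / h k).
  rewrite /h (ger0_norm u0); field; rewrite q0 andbT.
  by rewrite nat1r pnatr_eq0.
have h0 : h k @[k --> \oo] --> 0.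
  rewrite -oppr0; apply: cvgN; rewrite -(mul0r q); apply: cvgMl.
  exact: cvg_harmonic.
under eq_fun do rewrite hE.
(* For [q < 0] the increments [h k] are positive and the right derivative governs the limit; for
   [q > 0] they are negative and the left derivative does. *)
case: (ltgtP q 0) q0 => // q0 _.
  have -> : dir_deriv u q = - q * pp u.
    rewrite /dir_deriv /upper_part /lower_part nmulr_llt0// nmulr_lgt0//.
    rewrite [u < 0]ltNge u0 subr0; case: ltgtP u0 => // [u0 _|<- _].
      by rewrite gtr0_norm// ltr0_norm// mulrC.
    by rewrite pp0 mulr0.
  apply: cvgMr.
  have hp k : 0 < h k by rewrite oppr_gt0 pmulr_rlt0// invr_gt0.
  have /cvg_at_rightP/(_ h)/(_ (conj hp h0)) := slope_right_cvg u0.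
  by under eq_fun do rewrite -(@ger0_norm _ (u + h _)) ?addr_ge0 ?(ltW (hp _))//.
have {u0 uq} u0 : 0 < u by case: uq => // -[_ /lt_trans/(_ q0)]; rewrite ltxx.
have -> : dir_deriv u q = - q * pm u.
  rewrite /dir_deriv /upper_part /lower_part mulr_gt0// [_ < 0]ltNge mulr_ge0 ?ltW//.
  by rewrite sub0r !gtr0_norm// mulrC mulNr.
apply: cvgMr.
have hp k : h k < 0 by rewrite oppr_lt0 mulr_gt0// invr_gt0.
have /cvg_at_leftP/(_ h)/(_ (conj hp h0)) := slope_left_cvg u0.
(* The point [u + h k] may be negative for small [k], so the two sequences agree only eventually. *)
apply: cvg_trans; apply: near_eq_cvg; near=> k.
rewrite ger0_norm//.
have : - u < h k by near: k; apply: (cvgr_gt _ h0); rewrite oppr_lt0.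
by rewrite -subr_gt0 opprK addrC => /ltW.
Unshelve. all: by end_near. Qed.

(** * Strict convexity from a strictly increasing right derivative *)

Section strict.
Hypothesis pp_incr : forall s t, 0 <= s -> s < t -> pp s < pp t.

(** Strictness passes from [pp] to [pm] through the midpoint [r]: [pm s <= pp s < pp r <= psi ((r +
    t) / 2) <= pm t]. *)
Lemma pm_incr s t : 0 <= s -> s < t -> pm s < pm t.
Proof.
move=> s0 st; pose r := (s + t) / 2.
apply: (le_lt_trans (pm_le_pp s0)); apply: (@lt_le_trans _ _ (pp r)).
  by apply: pp_incr => //; rewrite /r; lra.
apply: (le_trans (pp_le_psi _ (_ : r < (r + t) / 2))); rewrite /r; try lra.
by apply: psi_le_pm; lra.
Qed.

(** Cutting at the midpoint, the second half has slope at least [pp c], which exceeds [pp a]. *)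
Lemma pp_slope_lt a b : 0 <= a -> a < b -> pp a * (b - a) < phi b - phi a.
Proof.
move=> a0 ab; pose c := (a + b) / 2.
have : pp a * (c - a) <= phi c - phi a by apply: pp_slope; rewrite /c; lra.
have : pp c * (b - c) <= phi b - phi c by apply: pp_slope; rewrite /c; lra.
have : pp a * (b - c) < pp c * (b - c).
  by rewrite ltr_pM2r ?pp_incr ?/c//; lra.
lra.
Qed.

Lemma pm_slope_lt a b : 0 <= a -> a < b -> phi b - phi a < pm b * (b - a).
Proof.
move=> a0 ab; pose c := (a + b) / 2.
have : phi c - phi a <= pm c * (c - a) by apply: pm_slope; rewrite /c; lra.
have : phi b - phi c <= pm b * (b - c) by apply: pm_slope; rewrite /c; lra.
have : pm c * (c - a) < pm b * (c - a).
  by rewrite ltr_pM2r ?pm_incr ?/c//; lra.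
lra.
Qed.

(** Strict subgradient inequality: the even extension of [phi] lies strictly above its one-sided
    tangents. *)
Lemma dir_deriv_lt u q : q != 0 ->
  dir_deriv u q < phi `|u - q| - phi `|u|.
Proof.
wlog u0 : u q / 0 <= u.
  move=> W q0; have [u0|u0] := leP 0 u; first exact: (W _ _ u0 q0).
  rewrite -dir_derivNN -(normrN u) -(normrN (u - q)) opprD.
  by apply: W; rewrite ?oppr_eq0// oppr_ge0 ltW.
move: u0; rewrite le_eqVlt => /predU1P[<-|u0] q0.
  rewrite /dir_deriv /upper_part /lower_part mul0r ltxx subrr sub0r normrN.
  by rewrite normr0 phi0 subr0 phi_gt0// normr_gt0.
case: (ltgtP q 0) q0 => // q0 _.
  have uq : u < u - q by rewrite ltrDl oppr_gt0.
  rewrite /dir_deriv /upper_part /lower_part nmulr_llt0// nmulr_lgt0// u0.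
  rewrite [u < 0]ltNge (ltW u0) subr0 gtr0_norm// ltr0_norm// ger0_norm; last lra.
  have := pp_slope_lt (ltW u0) uq; lra.
rewrite /dir_deriv /upper_part /lower_part mulr_gt0// [_ < 0]ltNge mulr_ge0 ?ltW//.
rewrite sub0r !(gtr0_norm u0) (gtr0_norm q0); have [uq|uq] := leP 0 (u - q).
  have : u - q < u by lra.
  by rewrite ger0_norm// => /(pm_slope_lt uq); lra.
(* Here the segment from [u] to [u - q] crosses 0: the tangent has already dropped below 0 at the
   origin, while [phi] is positive at the far end. *)
have : 0 < phi `|u - q| by rewrite phi_gt0// normr_gt0 lt_eqF.
have := pm_slope_lt (lexx 0) u0; rewrite phi0 !subr0.
have : pm u * u <= pm u * q by rewrite ler_wpM2l ?pm_ge0; lra.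
lra.
Qed.

Lemma dir_deriv_le u q : dir_deriv u q <= phi `|u - q| - phi `|u|.
Proof.
have [->|/dir_deriv_lt/ltW//] := eqVneq q 0.
by rewrite /dir_deriv /upper_part /lower_part mulr0 ltxx !subr0 subrr.
Qed.

(** Adding the strict inequality from [u] to [u - q] and the one back from [u - q] to [u] cancels
    the increments of [phi]. *)
Lemma dir_deriv_monotone u q : q != 0 -> dir_deriv u q + dir_deriv (u - q) (- q) < 0.
Proof.
move=> q0; have := dir_deriv_lt u q0.
have := @dir_deriv_lt (u - q) (- q); rewrite oppr_eq0 opprK subrK => /(_ q0).
lra.
Qed.

Lemma phi_incr_ge u q : - (pp `|u| * `|q|) <= phi `|u - q| - phi `|u|.
Proof.
apply: le_trans (dir_deriv_le u q); rewrite /dir_deriv.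
have := lower_part_le u q; have := upper_part_ge0 u q; lra.
Qed.

(** The upper estimate is the lower bound [phi_incr_ge] taken at [u - q] in the direction [- q]. *)
Lemma phi_incr_le u q : `|phi `|u - q| - phi `|u| | <= pp (`|u| + `|q|) * `|q|.
Proof.
have A : pp `|u| * `|q| <= pp (`|u| + `|q|) * `|q|.
  by rewrite ler_wpM2r// pp_nd// lerDl.
have B : pp `|u - q| * `|q| <= pp (`|u| + `|q|) * `|q|.
  by rewrite ler_wpM2r// pp_nd// ler_normB.
have := phi_incr_ge u q; have := phi_incr_ge (u - q) (- q).
rewrite opprK subrK normrN => C D; rewrite ler_norml; lra.
Qed.

End strict.

End convex_primitive.

(** * Best approximation in a finite-dimensional space *)

Section best_approximation_finite_dim.
Context d (T : measurableType d) (R : realType) (mu : {measure set T -> \bar R}).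
Context (psi phi : R -> R).
Hypotheses (psiS : class_S psi)
  (phiE : forall s, 0 <= s ->
     (phi s)%:E = (\int[lebesgue_measure]_(r in `[0%R, s]) (psi r)%:E)%E)
  (phiD : Delta2 phi)
  (pp_incr : forall s t, 0 <= s -> s < t -> psi_plus phi s < psi_plus phi t).
Local Notation pp := (psi_plus phi).
Local Notation pm := (psi_minus phi).
Context (D : set T) (f : T -> R).
Hypotheses (mD : measurable D) (Doo : (mu D < +oo)%E) (D0 : (0 < mu D)%E).
Hypotheses (mf : measurable_fun D f)
  (fL : (\int[mu]_(x in D) (pp `|f x|)%:E < +oo)%E).
Context (N : nat) (b : 'I_N -> T -> R) (B : R).
Hypotheses (mb : forall i, measurable_fun D (b i))
  (bB : forall i x, D x -> `|b i x| <= B).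

Definition lincomb (c : 'rV[R]_N) (x : T) : R := \sum_i c ord0 i * b i x.

(** Independence is required on every subset of positive measure; for monomials this is the
    statement about zero sets of polynomials. *)
Hypothesis b_indep : forall (c : 'rV[R]_N) (A : set T), measurable A ->
  A `<=` D -> (0 < mu A)%E -> (forall x, A x -> lincomb c x = 0) -> c = 0.

Implicit Types (c e : 'rV[R]_N) (s M : R).

Lemma lincombD c e x : lincomb (c + e) x = lincomb c x + lincomb e x.
Proof.
by rewrite -big_split; apply: eq_bigr => i _; rewrite mxE mulrDl.
Qed.

Lemma lincombZ s c x : lincomb (s *: c) x = s * lincomb c x.
Proof. by rewrite mulr_sumr; apply: eq_bigr => i _; rewrite mxE mulrA. Qed.

Lemma lincombN c x : lincomb (- c) x = - lincomb c x.
Proof. by rewrite -scaleN1r lincombZ mulN1r. Qed.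

Lemma lincombB c e x : lincomb (c - e) x = lincomb c x - lincomb e x.
Proof. by rewrite lincombD lincombN. Qed.

(** Factor comparing the uniform norm of a linear combination on [D] with the sup norm of its
    coefficients; no sign is assumed on [B], hence the absolute value. *)
Let beta : R := N%:R * `|B|.

Let beta_ge0 : 0 <= beta. Proof. by rewrite mulr_ge0. Qed.

Lemma coord_le_norm c i : `|c ord0 i| <= `|c|.
Proof.
rewrite [leRHS]/Num.norm/= mx_normrE; exact: (le_bigmax _ _ (ord0, i)).
Qed.

Lemma lincomb_le c x : D x -> `|lincomb c x| <= beta * `|c|.
Proof.
move=> Dx; apply: (le_trans (ler_norm_sum _ _ _)).
apply: (@le_trans _ _ (\sum_(i < N) `|B| * `|c|)).
  apply: ler_sum => i _; rewrite normrM mulrC ler_pM ?coord_le_norm//.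
  exact: le_trans (bB i Dx) (ler_norm _).
by rewrite sumr_const card_ord -mulrA mulr_natl.
Qed.

Lemma measurable_lincomb c : measurable_fun D (lincomb c).
Proof.
apply: measurable_sum => i; apply: measurable_funM => //; exact: mb.
Qed.

Lemma measurable_dev c : measurable_fun D (fun x => f x - lincomb c x).
Proof. by apply: measurable_funB => //; exact: measurable_lincomb. Qed.

Lemma measurable_nd_dev (g : R -> R) (h : T -> R) :
  (forall s t, 0 <= s -> s <= t -> g s <= g t) -> measurable_fun D h ->
  measurable_fun D (fun x => g `|h x|).
Proof.
by move=> gnd mh; apply: (measurableT_comp (measurable_nd_norm gnd) mh).
Qed.

Let dom s M x : R := pp (`|f x| + s) * M.

(** By [pp_quasi_subadd], the function is controlled by the sum of [pp] of the absolute value of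
    [f], integrable by hypothesis, and the constant [pp s] on a set of finite measure. *)
Lemma integrable_dom s M : 0 <= s -> mu.-integrable D (EFin \o dom s M).
Proof.
move=> s0.
have [K K0 ppK] := pp_quasi_subadd psiS phiE phiD.
have intf : mu.-integrable D (EFin \o (fun x => pp `|f x|)).
  apply/integrableP; split.
    by apply/measurable_EFinP; apply: measurable_nd_dev mf; exact: pp_nd psiS phiE.
  under eq_integral do rewrite /= ger0_norm ?(pp_ge0 psiS phiE)//.
  exact: fL.
have ints : mu.-integrable D (EFin \o cst (pp s)).
  apply: measurable_bounded_integrable => //.
  by exists `|pp s|; split => // r rs x Dx /=; rewrite ltW.
have int1 : mu.-integrable D (EFin \o (fun x => pp (`|f x| + s))).
  apply: (@le_integrable _ _ _ mu D mD _
      (fun x => K%:E * (EFin (pp `|f x|) + EFin (pp s)))%E).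
  - apply/measurable_EFinP.
    rewrite (_ : (fun x => _) = (fun x => pp `| (`|f x| + s) |)).
      apply: measurable_nd_dev; first exact: pp_nd psiS phiE.
      by apply: measurable_funD => //; exact: measurableT_comp.
    by apply/funext => x; rewrite (@ger0_norm _ (_ + s)) ?addr_ge0.
  - move=> x Dx; rewrite -EFinD -EFinM /= lee_fin.
    rewrite (ger0_norm (pp_ge0 psiS phiE (addr_ge0 (normr_ge0 _) s0))).
    by apply: le_trans (ler_norm _); exact: ppK.
  - by apply: integrableZl => //; apply: integrableD.
have := @integrableZl _ _ _ mu D mD M _ int1.
by congr (integrable _ _ _); apply/funext => x /=; rewrite /dom mulrC EFinM.
Qed.

Lemma integrable_le_dom s M (g : T -> R) : 0 <= s -> measurable_fun D g ->
  (forall x, D x -> `|g x| <= dom s M x) -> mu.-integrable D (EFin \o g).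
Proof.
move=> s0 mg gdom; apply: (le_integrable mD) (integrable_dom M s0).
  exact/measurable_EFinP.
by move=> x Dx; rewrite lee_fin (le_trans (gdom x Dx))// ler_norm.
Qed.

Definition excess c x : R := phi `|f x - lincomb c x| - phi `|f x|.

Lemma measurable_phi_dev c : measurable_fun D (fun x => phi `|f x - lincomb c x|).
Proof.
apply: measurable_nd_dev; first exact: phi_nd psiS phiE.
exact: measurable_dev.
Qed.

(** One estimate serves three purposes: integrability of the differences, local Lipschitz continuity
    of the energy, and domination of its difference quotients. *)
Lemma phi_dev_diff_le c e x : D x ->
  `|phi `|f x - lincomb (c + e) x| - phi `|f x - lincomb c x| | <=
  pp (`|f x| + beta * (`|c| + `|e|)) * (beta * `|e|).
Proof.
move=> Dx; have := phi_incr_le psiS phiE pp_incr (f x - lincomb c x) (lincomb e x).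
rewrite lincombD opprD addrA => /le_trans; apply.
apply: ler_pM; rewrite ?(pp_ge0 psiS phiE) ?addr_ge0 ?lincomb_le//.
apply: (pp_nd psiS phiE); first by rewrite addr_ge0.
rewrite mulrDr addrA lerD ?lincomb_le// (le_trans (ler_normB _ _))//.
by rewrite lerD2l lincomb_le.
Qed.

Lemma integrable_phi_dev_diff c e : mu.-integrable D
  (EFin \o (fun x => phi `|f x - lincomb (c + e) x| - phi `|f x - lincomb c x|)).
Proof.
apply: (@integrable_le_dom (beta * (`|c| + `|e|)) (beta * `|e|)).
- by rewrite mulr_ge0// addr_ge0.
- by apply: measurable_funB; exact: measurable_phi_dev.
- by move=> x; exact: phi_dev_diff_le.
Qed.

Lemma excessE c x : excess c x =
  phi `|f x - lincomb (0 + c) x| - phi `|f x - lincomb 0 x|.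
Proof.
by rewrite add0r -(scale0r (0 : 'rV[R]_N)) lincombZ mul0r subr0.
Qed.

Lemma integrable_excess c : mu.-integrable D (EFin \o excess c).
Proof.
have := integrable_phi_dev_diff 0 c.
by congr (integrable _ _ _); apply/funext => x /=; rewrite excessE.
Qed.

Definition energy c : R := \int[mu]_(x in D) excess c x.

Lemma energyB c e : energy (c + e) - energy c =
  \int[mu]_(x in D) (phi `|f x - lincomb (c + e) x| - phi `|f x - lincomb c x|).
Proof.
rewrite -RintegralB//; try exact: integrable_excess.
by apply: eq_Rintegral => x _; rewrite /excess; ring.
Qed.

Lemma loc_lipschitz_continuous (h : 'rV[R]_N -> R) :
  (forall c, exists2 K, 0 <= K & forall e, `|e| <= 1 -> `|h (c + e) - h c| <= K * `|e|) ->
  continuous h.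
Proof.
move=> hK c; have [K K0 hc] := hK c.
apply/(@cvgrPdist_le _ _ _ (nbhs c) _ h (h c)) => eps eps0; near=> x.
have xc1 : `|x - c| <= 1.
  near: x; exact: (@cvgr_distC_le _ _ _ (nbhs c) _ id c cvg_id 1 ltr01).
(* Dividing by [K + 1] rather than [K] covers the case [K = 0]. *)
have xceps : `|x - c| <= eps / (K + 1).
  near: x; apply: (@cvgr_distC_le _ _ _ (nbhs c) _ id c cvg_id).
  by rewrite divr_gt0// ltr_wpDl.
have := hc _ xc1; rewrite subrKC distrC => /le_trans; apply.
apply: (@le_trans _ _ (K * (eps / (K + 1)))); first by rewrite ler_wpM2l.
by rewrite mulrCA ler_piMr ?(ltW eps0)// ler_pdivrMr ?ltr_wpDl// mul1r lerDl.
Unshelve. all: by end_near. Qed.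

Lemma energy_continuous : continuous energy.
Proof.
apply: loc_lipschitz_continuous => c.
pose s := beta * (`|c| + 1).
have s0 : 0 <= s by rewrite mulr_ge0// addr_ge0.
exists (\int[mu]_(x in D) dom s beta x).
  apply: Rintegral_ge0 => x _; rewrite mulr_ge0// (pp_ge0 psiS phiE)//.
  exact: addr_ge0.
move=> e e1; rewrite energyB.
apply: le_trans (le_normr_Rintegral mD (integrable_phi_dev_diff c e)) _.
rewrite -RintegralZr//; last exact: integrable_dom.
apply: le_Rintegral => //.
- exact: integrable_norm (integrable_phi_dev_diff c e).
- have := integrable_dom (beta * `|e|) s0.
  by congr (integrable _ _ _); apply/funext => x /=; rewrite /dom mulrA.
- move=> x Dx; apply: le_trans (phi_dev_diff_le c e Dx) _.
  rewrite /dom mulrA !ler_wpM2r//; apply: (pp_nd psiS phiE).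
    by rewrite addr_ge0// mulr_ge0// addr_ge0.
  by rewrite lerD2l ler_wpM2l// lerD2l.
Qed.


(** If the integral were 0, [h] would vanish almost everywhere, hence [lincomb c] would vanish on
    [A] minus a null set, which still has positive measure, and [b_indep] would give [c = 0]. *)
Lemma pos_integral c (A : set T) (h : T -> R) : measurable A -> A `<=` D ->
  (0 < mu A)%E -> c != 0 -> mu.-integrable A (EFin \o h) ->
  (forall x, A x -> 0 <= h x) ->
  (forall x, A x -> lincomb c x != 0 -> 0 < h x) ->
  0 < \int[mu]_(x in A) h x.
Proof.
move=> mA AD A0 c0 ih h0 hpos; rewrite lt_neqAle Rintegral_ge0// andbT.
apply: contra_neqN c0 => /eqP/esym ih0.
have mh : measurable_fun A (EFin \o h) by case/integrableP: ih.
have abs0 : (\int[mu]_(x in A) `|(EFin \o h) x| = 0)%E.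
  rewrite (eq_integral (EFin \o h)); last first.
    by move=> x /set_mem Ax /=; rewrite ger0_norm// h0.
  rewrite -[LHS]fineK; last exact: integrable_fin_num.
  by congr EFin.
have [Z [mZ Z0 AZ]] := (ae_eq_integral_abs mu mA mh).1 abs0.
have mAZ : measurable (A `\` Z) by exact: measurableD.
apply: (b_indep mAZ).
- by move=> x [/AD].
- apply: (lt_le_trans A0); rewrite -[leRHS]adde0 -Z0.
  apply: (le_trans _ (measureU2 _ mAZ mZ)).
  apply: le_measure; rewrite ?inE//; first exact: measurableU.
  by move=> x Ax; have [Zx|Zx] := pselect (Z x); [right|left].
- move=> x [Ax nZx]; apply/eqP; apply: contraT => /(hpos _ Ax) hx.
  exfalso; apply: nZx; apply: AZ => /= /(_ Ax) [hx0].
  by move: hx; rewrite hx0 ltxx.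
Qed.

(** [D] is the countable union of the parts where [f] is bounded by an integer, so they cannot all
    be null. *)
Lemma exists_bounded_part : exists2 M : R, 0 <= M &
  (0 < mu (D `&` f @^-1` `[(- M)%R, M]))%E.
Proof.
pose F (k : nat) : set T := D `&` f @^-1` `[- k%:R, k%:R].
have mF k : measurable (F k) by apply: mf.
suff [k Fk] : exists k, (0 < mu (F k))%E by exists k%:R.
apply: contrapT => /forallNP F0.
have : (mu (\bigcup_k F k) <= \sum_(k <oo) mu (F k))%E.
  by apply: measure_sigma_subadditive => //; exact: bigcup_measurable.
rewrite eseries0; last first.
  move=> k _ _; apply/eqP; rewrite eq_le measure_ge0 andbT leNgt.
  by apply/negP; exact: F0.
rewrite (_ : \bigcup_k F k = D); first by rewrite leNgt D0.
apply/seteqP; split => [x [k _ []]//|x Dx].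
exists (Num.truncn `|f x|).+1 => //; split => //=.
rewrite in_itv/= -ler_norml ltW// truncnS_gt//.
Qed.

(** Equivalence of norms in finite dimension: [k] is the minimum over the compact unit sphere of the
    L1 norm on [A], positive by [pos_integral]. *)
Lemma exists_coercive_norm (A : set T) : measurable A -> A `<=` D ->
  (0 < mu A)%E -> exists2 k : R, 0 < k &
    forall c, k * `|c| <= \int[mu]_(x in A) `|lincomb c x|.
Proof.
move=> mA AD A0.
have Aoo : (mu A < +oo)%E by apply: le_lt_trans Doo; rewrite le_measure ?inE.
have mlin c : measurable_fun A (fun x => `|lincomb c x|).
  apply: measurableT_comp => //.
  by apply: measurable_funS (measurable_lincomb c).
have ilin c : mu.-integrable A (EFin \o (fun x => `|lincomb c x|)).
  apply: measurable_bounded_integrable => //.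
  exists (beta * `|c|); split; first exact: num_real.
  move=> r rs x Ax /=; rewrite normr_id; apply: (le_trans (lincomb_le c (AD x Ax))).
  exact: ltW.
pose L c := \int[mu]_(x in A) `|lincomb c x|.
have Lcont : continuous L.
  apply: loc_lipschitz_continuous => c; exists (beta * fine (mu A)).
    by rewrite mulr_ge0// fine_ge0.
  move=> e _; rewrite /L -RintegralB//.
  have iB := integrableB mA (ilin (c + e)) (ilin c).
  apply: (le_trans (le_normr_Rintegral mA iB)).
  rewrite mulrAC -Rintegral_cst//; apply: le_Rintegral => //.
  - exact: integrable_norm iB.
  - apply: measurable_bounded_integrable => //.
    by exists `|beta * `|e| |; split => // r rs x Ax /=; rewrite ltW.
  - move=> x Ax; apply: (le_trans (ler_dist_dist _ _)).
    by rewrite lincombD addrAC subrr add0r lincomb_le//; exact: AD.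
have Lpos c : c != 0 -> 0 < L c.
  move=> c0; apply: (pos_integral mA AD A0 c0) => // x Ax.
  by rewrite normr_gt0.
pose S : set 'rV[R]_N := [set c | `|c| = 1].
have [S0|S0] := pselect (S !=set0).
  have [c0 c0S c0min] : exists2 c0, c0 \in S & forall t, t \in S -> L c0 <= L t.
    apply: EVT_min_rV => //; last first.
      by apply: continuous_subspaceT.
    apply: bounded_closed_compact.
      by exists 1; split => // r r1 x /= ->; exact: ltW.
    have -> : S = (fun c : 'rV[R]_N => `|c|) @^-1` [set 1] by [].
    apply: closed_comp; last exact: closed_eq.
    by move=> x _; exact: norm_continuous.
  exists (L c0).
    apply: Lpos; rewrite -normr_gt0.
    by move: c0S => /set_mem ->.
  move=> c; have [->|cn0] := eqVneq c 0.
    by rewrite normr0 mulr0 Rintegral_ge0.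
  have c_gt0 : 0 < `|c| by rewrite normr_gt0.
  rewrite -ler_pdivlMr//.
  have : `|c|^-1 *: c \in S.
    by apply/mem_set; rewrite /S /= normrZ ger0_norm ?invr_ge0// mulVf// gt_eqF.
  move=> /c0min/le_trans; apply; rewrite /L.
  under eq_Rintegral do rewrite lincombZ normrM ger0_norm ?invr_ge0//.
  by rewrite RintegralZl// mulrC.
(* If there is no unit vector, as for [N = 0], every [c] is 0 and any positive constant will do. *)
exists 1 => // c; suff -> : c = 0 by rewrite normr0 mulr0 Rintegral_ge0.
apply/eqP; apply: contra_notT S0 => c0.
by exists (`|c|^-1 *: c); rewrite /S /= normrZ ger0_norm ?invr_ge0// mulVf// normr_eq0.
Qed.

(** On a part [A] where [f] is bounded, superlinearity of [phi] yields a gain proportional to the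
    norm of [c] with an arbitrarily large factor; elsewhere [phi_incr_ge] bounds the loss by a fixed
    multiple of that norm. *)
Lemma energy_coercive : exists C, forall c, `|c| - C <= energy c.
Proof.
have [M M0 A0] := exists_bounded_part.
set A := D `&` _ in A0.
have mA : measurable A by apply: mf.
have AD : A `<=` D by move=> x [].
have [k k0 kc] := exists_coercive_norm mA AD A0.
pose I0 := \int[mu]_(x in D) pp `|f x|.
have I0_ge0 : 0 <= I0 by apply: Rintegral_ge0 => x _; rewrite (pp_ge0 psiS phiE).
(* With this slope, [K * k = beta * I0 + 1]: the gain on [A] absorbs the loss [beta * I0] and leaves
   coefficient 1. *)
pose K := (beta * I0 + 1) / k.
have K0 : 0 <= K by rewrite divr_ge0 ?addr_ge0 ?mulr_ge0// ltW.
have [C0 C00 KC0] := phi_superlinear psiS phiE K0.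
pose C1 := K * M + C0 + phi M.
have C10 : 0 <= C1.
  apply: addr_ge0; last exact: (phi_ge0 psiS phiE).
  by apply: addr_ge0 => //; exact: mulr_ge0.
have ipp : mu.-integrable D (EFin \o (fun x => pp `|f x|)).
  have := integrable_dom 1 (lexx 0).
  by congr (integrable _ _ _); apply/funext => x /=; rewrite /dom addr0 mulr1.
have mlin c : measurable_fun D ((fun x => `|lincomb c x|) \_ A).
  apply/measurable_restrict => //; rewrite setIidr//.
  apply: measurableT_comp => //.
  by apply: measurable_funS (measurable_lincomb c).
have ilin c : mu.-integrable D (EFin \o ((fun x => `|lincomb c x|) \_ A)).
  apply: measurable_bounded_integrable => //.
  exists (beta * `|c|); split; first exact: num_real.
  move=> r rs x Dx /=; rewrite patchE; case: ifPn => _.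
    by rewrite normr_id; apply: (le_trans (lincomb_le c Dx)); exact: ltW.
  rewrite normr0 (le_trans _ (ltW rs))// mulr_ge0//.
have icst r : mu.-integrable D (EFin \o cst r).
  apply: measurable_bounded_integrable => //.
  by exists `|r|; split => // s rs x Dx /=; rewrite ltW.
exists (C1 * fine (mu D)) => c.
(* On [A], the triangle inequality and [phi_superlinear] give the bound, [C1] collecting the terms
   due to [f]; the loss term is subtracted on all of [D] so that both cases share one formula. *)
have lower x : D x -> K * ((fun x => `|lincomb c x|) \_ A) x -
    (pp `|f x| * (beta * `|c|) + C1) <= excess c x.
  move=> Dx; have ppx : 0 <= pp `|f x| by rewrite (pp_ge0 psiS phiE).
  have bc : 0 <= beta * `|c| by rewrite mulr_ge0.
  rewrite patchE; case: ifPn => [/set_mem[_ /=]|_].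
    rewrite in_itv/= -ler_norml => fM.
    have : phi `|f x| <= phi M by apply: (phi_nd psiS phiE).
    have := KC0 _ (normr_ge0 (f x - lincomb c x)).
    have : K * `|lincomb c x| <= K * `|f x - lincomb c x| + K * `|f x|.
      rewrite -mulrDr ler_wpM2l// addrC; apply: le_trans (ler_normB _ _).
      by rewrite subKr.
    have : K * `|f x| <= K * M by rewrite ler_wpM2l.
    have : 0 <= pp `|f x| * (beta * `|c|) by rewrite mulr_ge0.
    rewrite /excess /C1; lra.
  have := phi_incr_ge psiS phiE pp_incr (f x) (lincomb c x).
  have : pp `|f x| * `|lincomb c x| <= pp `|f x| * (beta * `|c|).
    by rewrite ler_wpM2l// lincomb_le.
  rewrite /excess /= mulr0; lra.
have iK : mu.-integrable D (EFin \o (fun x => K * ((fun x => `|lincomb c x|) \_ A) x)).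
  exact: (integrableZl mD K (ilin c)).
have iP : mu.-integrable D (EFin \o (fun x => pp `|f x| * (beta * `|c|))).
  have := integrable_dom (beta * `|c|) (lexx 0).
  by congr (integrable _ _ _); apply/funext => x /=; rewrite /dom addr0.
have iPC : mu.-integrable D (EFin \o (fun x => pp `|f x| * (beta * `|c|) + C1)).
  exact: (integrableD mD iP (icst C1)).
have := le_Rintegral mD (integrableB mD iK iPC) (integrable_excess c) lower.
rewrite RintegralB// RintegralD//; last exact: icst.
rewrite RintegralZr// (RintegralZl K mD (ilin c)).
rewrite Rintegral_cst// -Rintegral_mkcondr setIidr// -/I0 -/(energy c).
apply: le_trans; rewrite opprD addrA lerD2r.
have : K * (k * `|c|) <= K * \int[mu]_(x in A) `|lincomb c x|.
  by rewrite ler_wpM2l.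
rewrite /K [_ / k * (k * _)]mulrA divfK ?gt_eqF//.
rewrite -/K; lra.
Qed.

(** Outside the ball of radius [C + 1] coercivity makes the energy exceed its value 0 at the origin,
    so a minimiser on that compact ball is global. *)
Lemma exists_energy_min : exists c, forall e, energy c <= energy e.
Proof.
have [C JC] := energy_coercive.
have J0 : energy 0 = 0.
  rewrite /energy -[RHS](mul0r (fine (mu D))) -Rintegral_cst//.
  by apply: eq_Rintegral => x _; rewrite excessE addr0 subrr.
have C0 : 0 <= C by have := JC 0; rewrite normr0 J0 sub0r oppr_le0.
pose S : set 'rV[R]_N := [set c | `|c| <= C + 1].
have [c cS cmin] : exists2 c, c \in S & forall t, t \in S -> energy c <= energy t.
  apply: EVT_min_rV.
  - by exists 0; rewrite /S /= normr0 addr_ge0.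
  - apply: bounded_closed_compact.
      exists (C + 1); split; first exact: num_real.
      by move=> r r1 x /= xC; rewrite (le_trans xC)// ltW.
    have -> : S = (fun c : 'rV[R]_N => `|c|) @^-1` [set x | x <= C + 1] by [].
    apply: closed_comp; last exact: closed_le.
    by move=> x _; exact: norm_continuous.
  - by apply: continuous_subspaceT; exact: energy_continuous.
exists c => e; have [eS|eS] := leP `|e| (C + 1).
  by apply: cmin; apply/mem_set.
apply: (@le_trans _ _ (energy 0)).
  by apply: cmin; apply/mem_set; rewrite /S /= normr0 addr_ge0.
by rewrite J0; apply: le_trans (JC e); lra.
Qed.


(** * First variation of the energy *)

Lemma mulr_gt0_cases (u q : R) :
  (0 < u * q) = (0 < u) && (0 < q) || (u < 0) && (q < 0).
Proof.
case: (ltgtP q 0) => [q0|q0|->]; rewrite ?andbF ?andbT ?orbF ?orFb.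
- by rewrite nmulr_lgt0.
- by rewrite pmulr_lgt0.
- by rewrite mulr0 ltxx.
Qed.

Lemma mulr_lt0_cases (u q : R) :
  (u * q < 0) = (u < 0) && (0 < q) || (0 < u) && (q < 0).
Proof.
rewrite -oppr_gt0 -mulNr mulr_gt0_cases oppr_gt0 oppr_lt0.
by [].
Qed.

Definition energy_variation c e x : R := dir_deriv phi (f x - lincomb c x) (lincomb e x).

Lemma measurable_lt_set (g h : T -> R) : measurable_fun D g ->
  measurable_fun D h -> measurable (D `&` [set x | g x < h x]).
Proof.
move=> mg mh; have := measurable_fun_ltr mg mh mD (Y := [set true]) I.
by congr measurable; apply/seteqP; split.
Qed.

Lemma measurable_if_lt (g h k : T -> R) : measurable_fun D g ->
  measurable_fun D h -> measurable_fun D k ->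
  measurable_fun D (fun x => if g x < h x then k x else 0).
Proof.
move=> mg mh mk; apply: measurable_fun_if => //.
  exact: measurable_fun_ltr.
by apply: measurable_funS mk => // x [].
Qed.

Let dev c x : R := f x - lincomb c x.

Lemma measurable_pp_dev c e :
  measurable_fun D (fun x => pp `|dev c x| * `|lincomb e x|).
Proof.
apply: measurable_funM; last first.
  by apply: measurableT_comp => //; exact: measurable_lincomb.
by apply: measurable_nd_dev; [exact: pp_nd psiS phiE|exact: measurable_dev].
Qed.

Lemma measurable_pm_dev c e :
  measurable_fun D (fun x => pm `|dev c x| * `|lincomb e x|).
Proof.
apply: measurable_funM; last first.
  by apply: measurableT_comp => //; exact: measurable_lincomb.
by apply: measurable_nd_dev; [exact: pm_nd psiS phiE|exact: measurable_dev].
Qed.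

Lemma measurable_dev_lincomb c e :
  measurable_fun D (fun x => dev c x * lincomb e x).
Proof.
by apply: measurable_funM; [exact: measurable_dev|exact: measurable_lincomb].
Qed.

Lemma measurable_upper c e :
  measurable_fun D (fun x => upper_part phi (dev c x) (lincomb e x)).
Proof.
apply: measurable_if_lt => //; first exact: measurable_dev_lincomb.
exact: measurable_pp_dev.
Qed.

Lemma measurable_lower c e :
  measurable_fun D (fun x => lower_part phi (dev c x) (lincomb e x)).
Proof.
apply: measurable_if_lt => //; first exact: measurable_dev_lincomb.
exact: measurable_pm_dev.
Qed.

Lemma pp_dev_le_dom c e x : D x -> pp `|dev c x| * `|lincomb e x| <=
  dom (beta * `|c|) (beta * `|e|) x.
Proof.
move=> Dx; apply: ler_pM => //; rewrite ?(pp_ge0 psiS phiE) ?lincomb_le//.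
apply: (pp_nd psiS phiE) => //; rewrite (le_trans (ler_normB _ _))//.
by rewrite lerD2l lincomb_le.
Qed.

Lemma integrable_upper c e :
  mu.-integrable D (EFin \o (fun x => upper_part phi (dev c x) (lincomb e x))).
Proof.
apply: (@integrable_le_dom (beta * `|c|) (beta * `|e|)).
- by rewrite mulr_ge0.
- exact: measurable_upper.
- move=> x Dx; rewrite ger0_norm ?(upper_part_ge0 psiS phiE)//.
  apply: le_trans (pp_dev_le_dom c e Dx).
  exact: (upper_part_le psiS phiE).
Qed.

Lemma integrable_lower c e :
  mu.-integrable D (EFin \o (fun x => lower_part phi (dev c x) (lincomb e x))).
Proof.
apply: (@integrable_le_dom (beta * `|c|) (beta * `|e|)).
- by rewrite mulr_ge0.
- exact: measurable_lower.
- move=> x Dx; rewrite ger0_norm ?(lower_part_ge0 psiS phiE)//.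
  apply: le_trans (pp_dev_le_dom c e Dx).
  exact: (lower_part_le psiS phiE).
Qed.

Lemma integrable_variation c e : mu.-integrable D (EFin \o energy_variation c e).
Proof. exact: (integrableB mD (integrable_upper c e) (integrable_lower c e)). Qed.

Lemma energy_min_variation c e : (forall c', energy c <= energy c') ->
  0 <= \int[mu]_(x in D) energy_variation c e x.
Proof.
move=> cmin.
pose q k x := k.+1%:R *
  (phi `|f x - lincomb (c + k.+1%:R^-1 *: e) x| - phi `|f x - lincomb c x|).
have iq k : mu.-integrable D (EFin \o q k).
  exact: (integrableZl mD k.+1%:R (integrable_phi_dev_diff _ _)).
have q_ge0 k : (0 <= \int[mu]_(x in D) (q k x)%:E)%E.
  rewrite -[leRHS]fineK; last exact: (integrable_fin_num mD (iq k)).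
  rewrite lee_fin -/(Rintegral _ _ _) RintegralZl//; last exact: integrable_phi_dev_diff.
  by rewrite -energyB mulr_ge0// subr_ge0.
have : (\int[mu]_(x in D) (q k x)%:E)%E @[k --> \oo] -->
    (\int[mu]_(x in D) (energy_variation c e x)%:E)%E.
  apply: (@dominated_cvg _ _ _ mu D mD _ _
    (EFin \o dom (beta * (`|c| + `|e|)) (beta * `|e|))) => //.
  - by move=> k; case/integrableP: (iq k).
  - move=> x Dx; apply: cvg_EFin; first by apply: nearW.
    rewrite (_ : _ \o _ = fun k => k.+1%:R * (phi `|dev c x -
        k.+1%:R^-1 * lincomb e x| - phi `|dev c x|)).
      exact: (dir_deriv_cvg psiS phiE).
    by apply/funext => k; rewrite /= /q lincombD lincombZ opprD addrA.
  - by apply: integrable_dom; rewrite mulr_ge0// addr_ge0.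
  (* The factor [k + 1] cancels against the size of the increment [e / (k + 1)], whose norm is at
     most that of [e]; the bound is therefore uniform in [k]. *)
  - move=> k x Dx; rewrite /= lee_fin /q normrM normr_nat.
    apply: (le_trans (ler_wpM2l _ (phi_dev_diff_le c (k.+1%:R^-1 *: e) Dx))) => //.
    have ke : `|k.+1%:R^-1 *: e| = k.+1%:R^-1 * `|e|.
      by rewrite normrZ ger0_norm// invr_ge0.
    have kle : k.+1%:R^-1 * `|e| <= `|e|.
      by rewrite ler_piMl// invf_le1// ler1n.
    rewrite ke /dom mulrCA [k.+1%:R * (_ * _)]mulrCA [k.+1%:R * _]mulrA.
    rewrite divff ?pnatr_eq0// mul1r.
    rewrite ler_wpM2r ?mulr_ge0//.
    apply: (pp_nd psiS phiE); first by rewrite addr_ge0 ?mulr_ge0 ?addr_ge0 ?mulr_ge0.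
    by rewrite lerD2l ler_wpM2l// lerD2l.
move=> q_cvg; rewrite -lee_fin fineK.
  move/cvg_lim : (q_cvg) => <-//; apply: lime_ge.
    by apply/cvg_ex; eexists; exact: q_cvg.
  by apply: nearW => k; exact: q_ge0.
exact: (integrable_fin_num mD (integrable_variation c e)).
Qed.

(** The variations at [c1] towards [c2] and at [c2] towards [c1] have an integrand sum that is
    negative wherever the two combinations differ; if [c1 != c2], [pos_integral] makes the total
    negative. *)
Lemma variation_unique c1 c2 :
  (forall e, 0 <= \int[mu]_(x in D) energy_variation c1 e x) ->
  (forall e, 0 <= \int[mu]_(x in D) energy_variation c2 e x) -> c1 = c2.
Proof.
move=> v1 v2; apply/eqP; rewrite -subr_eq0 -oppr_eq0 opprB; apply: contraT => c0.
pose h x := - (energy_variation c1 (c2 - c1) x + energy_variation c2 (c1 - c2) x).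
have ih : mu.-integrable D (EFin \o h).
  have := integrableN (integrableD mD (integrable_variation c1 (c2 - c1))
    (integrable_variation c2 (c1 - c2))).
  by [].
(* Since [f - lincomb c2 = (f - lincomb c1) - lincomb (c2 - c1)], the sum has the form treated by
   [dir_deriv_monotone]. *)
have hE x : h x = - (dir_deriv phi (dev c1 x) (lincomb (c2 - c1) x) +
    dir_deriv phi (dev c1 x - lincomb (c2 - c1) x) (- lincomb (c2 - c1) x)).
  rewrite /h /energy_variation /dev !lincombB !opprB; congr (- (_ + dir_deriv _ _ _)).
  by ring.
have h_gt0 x : lincomb (c2 - c1) x != 0 -> 0 < h x.
  by rewrite hE oppr_gt0; exact: (dir_deriv_monotone psiS phiE pp_incr).
have : 0 < \int[mu]_(x in D) h x.
  apply: (pos_integral mD (fun _ => id) D0 c0 ih) => x _; last exact: h_gt0.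
  have [l0|/h_gt0/ltW//] := eqVneq (lincomb (c2 - c1) x) 0.
  by rewrite hE l0 subr0 oppr0 /dir_deriv /upper_part /lower_part mulr0 ltxx
    subrr addr0 oppr0.
have -> : \int[mu]_(x in D) h x = - (\int[mu]_(x in D) energy_variation c1 (c2 - c1) x +
    \int[mu]_(x in D) energy_variation c2 (c1 - c2) x).
  rewrite -RintegralD//; try exact: integrable_variation.
  rewrite -mulN1r -RintegralZl//.
    by apply: eq_Rintegral => x _; rewrite /h mulN1r.
  exact: (integrableD mD (integrable_variation c1 (c2 - c1))
    (integrable_variation c2 (c1 - c2))).
by rewrite oppr_gt0 ltNge addr_ge0.
Qed.

(** Merges the integrals over two disjoint sign regions into one over [D] by extending the integrand
    by 0. *)
Lemma integral_two_cases (g : T -> R) (k : T -> R) (A1 A2 : set T) :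
  measurable (D `&` A1) -> measurable (D `&` A2) -> A1 `&` A2 = set0 ->
  measurable_fun D g -> (forall x, 0 <= g x) ->
  (forall x, k x = if x \in A1 `|` A2 then g x else 0) ->
  (\int[mu]_(x in D `&` A1) (g x)%:E + \int[mu]_(x in D `&` A2) (g x)%:E =
   \int[mu]_(x in D) (k x)%:E)%E.
Proof.
move=> m1 m2 A12 mg g0 kE; rewrite -ge0_integral_setU//.
- rewrite -setIUr integral_mkcondr; apply: eq_integral => x _.
  by rewrite patchE kE; case: ifP.
- apply/measurable_EFinP; apply: measurable_funS mg => //.
  by move=> x [] [].
- by move=> x _; rewrite lee_fin.
- by apply/disj_setPS => x [[_ x1] [_ x2]]; rewrite -A12.
Qed.

Definition side_integral (g : R -> R) (c e : 'rV[R]_N) (A : set T) : \bar R :=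
  (\int[mu]_(x in D `&` A) (g `|f x - lincomb c x| * `|lincomb e x|)%:E)%E.

(** The left side is the integral of [lower_part], the right side that of [upper_part]. Both are
    finite, so the inequality in the extended reals is equivalent to the nonnegativity of the
    integral of their difference. *)
Lemma variational_ineqP c e :
  let p := lincomb c in let q := lincomb e in
  (side_integral pm c e ([set x | (f x > p x)%R] `&` [set x | (q x > 0)%R]) +
   side_integral pm c e ([set x | (f x < p x)%R] `&` [set x | (q x < 0)%R]) <=
   side_integral pp c e ([set x | (f x < p x)%R] `&` [set x | (q x > 0)%R]) +
   side_integral pp c e ([set x | (f x > p x)%R] `&` [set x | (q x < 0)%R]))%E <->
  0 <= \int[mu]_(x in D) energy_variation c e x.
Proof.
move=> p q.
have mp : measurable_fun D p by exact: measurable_lincomb.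
have mq : measurable_fun D q by exact: measurable_lincomb.
have mz : measurable_fun D (fun=> 0 : R) by exact: measurable_cst.
have mI (A B0 : set T) : measurable (D `&` A) -> measurable (D `&` B0) ->
    measurable (D `&` (A `&` B0)).
  by move=> mA mB0; rewrite -(setIid D) setIACA; exact: measurableI.
have mpf := measurable_lt_set mp mf; have mfp := measurable_lt_set mf mp.
have mq0 := measurable_lt_set mq mz; have m0q := measurable_lt_set mz mq.
have g0 (g : R -> R) : (forall s, 0 <= s -> 0 <= g s) ->
  forall x, 0 <= g `|f x - lincomb c x| * `|lincomb e x|.
  by move=> gp x; rewrite mulr_ge0// gp.
have inb (P : pred T) x : (x \in [set y | P y]) = P x.
  by apply/idP/idP => [/set_mem|/mem_set].
rewrite /side_integral.
rewrite (@integral_two_cases _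
  (fun x => lower_part phi (dev c x) (lincomb e x))); last 4 first.
- by apply/seteqP; split => // x [[/= a _] [b0 _]]; move: (lt_trans a b0); rewrite ltxx.
- exact: measurable_pm_dev.
- by apply: g0 => s; exact: (pm_ge0 psiS phiE).
- move=> x; rewrite /lower_part in_setU !in_setI !inb mulr_gt0_cases.
  by rewrite !subr_gt0 subr_lt0.
rewrite (@integral_two_cases _
  (fun x => upper_part phi (dev c x) (lincomb e x))); last 4 first.
- by apply/seteqP; split => // x [[/= a _] [b0 _]]; move: (lt_trans a b0); rewrite ltxx.
- exact: measurable_pp_dev.
- by apply: g0 => s; exact: (pp_ge0 psiS phiE).
- move=> x; rewrite /upper_part in_setU !in_setI !inb mulr_lt0_cases.
  by rewrite !subr_gt0 subr_lt0.
rewrite /energy_variation RintegralB ?subr_ge0; [|exact: mD|exact: integrable_upper|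
  exact: integrable_lower].
rewrite -lee_fin !fineK//.
- exact: (integrable_fin_num mD (integrable_upper c e)).
- exact: (integrable_fin_num mD (integrable_lower c e)).
- exact: mI.
- exact: mI.
- exact: mI.
- exact: mI.
Qed.

End best_approximation_finite_dim.

(** * Polynomials of bounded degree *)

Section monomial_basis.
Context {R : realType} {n : nat} (m : nat).
Local Notation E := (euclid R n).
Local Notation pol := (mpoly.mpoly n.+1 R).
Local Notation mnm := (mpoly.bmultinom n.+1 m.+1).
Local Notation N := #|{: mnm}|.

(** Monomials are indexed by ordinals to fit [lincomb]. The bound in [bmultinom] is strict, so
    [m.+1] gives the exponents of degree at most [m]. *)
Definition monomial (i : 'I_N) : pol := mpoly.mpolyX R (mpoly.bmnm (enum_val i)).

Definition poly_of (c : 'rV[R]_N) : pol := \sum_i c ord0 i *: monomial i.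

Lemma poly_of_Pi c : Pi_space m (poly_of c).
Proof.
apply: (leq_trans (mpoly.mmeasure_sum _ _ _ _)); apply/bigmax_leqP => i _.
apply: (leq_trans (mpoly.mmeasureZ_le _ _ _)).
by rewrite mpoly.mmeasureX; exact: mpoly.bmdeg.
Qed.

Lemma Pi_poly_of P : Pi_space m P -> exists c, P = poly_of c.
Proof.
move=> mP; exists (\row_i mpoly.mcoeff (mpoly.bmnm (enum_val i)) P).
rewrite [LHS](mpoly.mpolywE mP) /poly_of.
under [RHS]eq_bigr do rewrite mxE.
by rewrite -(big_enum_val (A := {: mnm}) (fun k : mnm =>
  mpoly.mcoeff (mpoly.bmnm k) P *: mpoly.mpolyX R (mpoly.bmnm k))).
Qed.

Lemma peval_poly_of c :
  peval (poly_of c) = lincomb (fun i => peval (monomial i)) c.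
Proof.
apply/funext => x; rewrite /peval /poly_of raddf_sum /=.
by apply: eq_bigr => i _; rewrite mpoly.mevalZ.
Qed.

Lemma poly_of_eq0 c : poly_of c = 0 -> c = 0.
Proof.
move=> c0; apply/rowP => i; rewrite mxE.
have := congr1 (mpoly.mcoeff (mpoly.bmnm (enum_val i))) c0.
rewrite mpoly.mcoeff0 raddf_sum /= (bigD1 i)//= mpoly.mcoeffZ mpoly.mcoeffX eqxx mulr1.
rewrite big1 ?addr0// => j ji; rewrite mpoly.mcoeffZ mpoly.mcoeffX.
case: eqP => [/val_inj/enum_val_inj ij|_]; last by rewrite mulr0.
by rewrite ij eqxx in ji.
Qed.

Lemma monomial_bounded (A : set E) : bounded_set (A : set 'rV[R]_n.+1) ->
  exists B, forall i x, A x -> `|peval (monomial i) x| <= B.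
Proof.
move=> /bounded_setP[M AM].
pose K (i : 'I_N) : R :=
  \prod_(j < n.+1) M ^+ mpoly.fun_of_multinom (mpoly.bmnm (enum_val i)) j.
(* Summing the individual bounds gives a single constant for all monomials. *)
exists (\sum_i `|K i|) => i x Ax; rewrite (bigD1 i)//= ler_wpDr ?sumr_ge0//.
apply: le_trans (ler_norm _); rewrite /peval mpoly.mevalX normr_prod.
apply: ler_prod => j _; rewrite normr_ge0/= normrX.
by apply: lerXn2r; rewrite ?nnegrE ?normr_ge0 ?(le_trans (normr_ge0 _) (AM x Ax j)) ?AM.
Qed.

End monomial_basis.

Theorem theorem4p1 (R : realType) (n m : nat) (Omega : set (euclid R n))
    (Omega_bounded : bounded_set (Omega : set 'rV[R]_n.+1))
    (Omega_measurable : measurable Omega)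
    (Omega_pos : (0 < lebesgue Omega)%E)
    (phi : R -> R) (phi_Phi : class_Phi phi)
    (psi_plus_incr : forall s t : R,
       0 <= s -> s < t -> psi_plus phi s < psi_plus phi t)
    (f : euclid R n -> R) (f_L : L_psi_plus phi Omega f) :
  exists! P : mpoly.mpoly n.+1 R, mu_psi_plus phi Omega m f P.
Proof.
have [[psi psiS phiE] phiD] := phi_Phi.
have [mf fL] := f_L.
have Ooo : (lebesgue Omega < +oo)%E by exact: bounded_lebesgue_fin.
have [B bB] := monomial_bounded m Omega_bounded.
pose b := fun i => peval (@monomial R n m i).
have mb i : measurable_fun Omega (b i) by exact: measurable_peval.
have b_indep c (A : set (euclid R n)) : measurable A -> A `<=` Omega ->
    (0 < lebesgue A)%E -> (forall x, A x -> lincomb b c x = 0) -> c = 0.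
  move=> mA AO A0 cA; apply: poly_of_eq0.
  apply: (mpoly_eq0_pos_measure mA _ A0).
    have /bounded_setP[M OM] := Omega_bounded.
    by apply/bounded_setP; exists M => x /AO; exact: OM.
  by move=> x Ax; rewrite peval_poly_of; exact: cA.
(* Every competitor [Q] is some [poly_of e], so membership is the nonnegativity of the first
   variation in all directions [e]. *)
have muP c : mu_psi_plus phi Omega m f (poly_of c) <->
    forall e, 0 <= \int[@lebesgue R n]_(x in Omega) energy_variation phi f b c e x.
  split=> [[_ Pc] e|vc].
    apply/(variational_ineqP psiS phiE phiD Omega_measurable Ooo mf fL mb bB).
    by have := Pc _ (poly_of_Pi e); rewrite !peval_poly_of.
  split; first exact: poly_of_Pi.
  move=> Q /Pi_poly_of[e ->]; rewrite !peval_poly_of.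
  exact/(variational_ineqP psiS phiE phiD Omega_measurable Ooo mf fL mb bB).
have [c cmin] := exists_energy_min psiS phiE phiD psi_plus_incr Omega_measurable
  Ooo Omega_pos mf fL mb bB b_indep.
have muc e := energy_min_variation psiS phiE phiD psi_plus_incr Omega_measurable
  Ooo mf fL mb bB e cmin.
exists (poly_of c); split; first exact/muP.
(* Any other element also has coordinates in the monomial basis, so uniqueness reduces to
   [variation_unique]. *)
move=> P mP; have [c' Pc'] := Pi_poly_of mP.1.
rewrite Pc'; congr poly_of; rewrite Pc' in mP.
apply: (variation_unique psiS phiE phiD psi_plus_incr Omega_measurable Ooo
  Omega_pos mf fL mb bB b_indep) => //.
exact/muP.
Qed.
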